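(* Let $A=KQ/\langle Z\rangle$ be a finite-dimensional folded gentle algebra and let $\widehat A=K\widehat Q/\langle\widehat Z\rangle$ be the unfolded gentle algebra corresponding to $A$ via the unfolding procedure. Let $\mathbb Z_2=\{1,g\}$ be the group that acts on $\widehat A$. For a gentle or folded gentle algebra $A'$ let $\mathcal S_{A'}$ and $\mathcal B_{A'}$ be the classes of all strings and of all bands of $A'$, up to the equivalences $\approx$. Then the following hold. (a) $\mathbb Z_2$ acts on $\mathcal S_{\widehat A}$ and $\mathcal B_{\widehat A}$. (b) There is a bijection $\mathcal S_A\cong\mathcal S_{\widehat A}/\mathbb Z_2$. In particular, there exists a surjection $\rho\colon\mathcal S_{\widehat A}\to\mathcal S_A$ such that (i) $\rho(\widehat w)\approx\rho(\widehat w')$ if and only if $\widehat w'\approx\widehat w$ or $\widehat w'\approx g\widehat w$; and (ii) $\rho(\widehat w)\in\mathcal S_A$ is symmetric if and only if $\widehat w\in\mathcal S_{\widehat A}$ is $\mathbb Z_2$-invariant (that is, $g\widehat w\approx\widehat w$). (c) There is a bijection $\mathcal B_A\cong\mathcal B_{\widehat A}/\mathbb Z_2$. In particular, there exists a surjection $\rho\colon\mathcal B_{\widehat A}\to\mathcal B_A$ such that (i) $\rho(\widehat w)\approx\rho(\widehat w')$ if and only if $\widehat w'\approx\widehat w$ or $\widehat w'\approx g\widehat w$; (ii) $\rho(\widehat w)\in\mathcal B_A$ has an odd number of crease symbols (and is hence asymmetric) if and only if $\widehat w\approx(g\widehat w')\widehat w'$ for some subword $\widehat w'$ of $\widehat w$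 (and $\widehat w$ is hence $\mathbb Z_2$-invariant); (iii) $\rho(\widehat w)\in\mathcal B_A$ is asymmetric with an even number of crease symbols if and only if $\widehat w$ is not $\mathbb Z_2$-invariant; and (iv) $\rho(\widehat w)\in\mathcal B_A$ is symmetric if and only if $\widehat w\approx(g\widehat w')^{-1}\widehat w'$ for some subword $\widehat w'$ of $\widehat w$ (and $\widehat w$ is hence $\mathbb Z_2$-invariant).
   Context: Paths in a quiver compose left to right: $\alpha_1\cdots\alpha_n$ is a path iff $t(\alpha_i)=s(\alpha_{i+1})$; $\varepsilon_v$ is the stationary path at $v$. Folded gentle triple $(K,Q,Z)$: $K$ is a field; $Q$ is a finite quiver with $Q_0=Q_0^{(1)}\sqcup Q_0^{(2)}$ (ordinary and crease vertices) and $Q_1=Q_1^{(1)}\sqcup Q_1^{(2)}$ (ordinary arrows and crease loops), where $Q_1^{(2)}=\{\eta_v : v\in Q_0^{(2)}\}$ with $\eta_v$ a loop at $v$; $Z=Z^{(1)}\sqcup Z^{(2)}\subseteq KQ$, where $Z^{(1)}$ is a set of paths of length at least $2$ in $Q\setminus Q_1^{(2)}$ and $Z^{(2)}=\{\eta_v^2-\lambda_{v,1}\eta_v-\lambda_{v,2}\varepsilon_v : v\in Q_0^{(2)}\}$ with $\lambda_{v,1},\lambda_{v,2}\in K$; such that: (FG1) every vertex is the source of at most two arrows and the target of at most two arrows; (FG2) for each $\beta\in Q_1^{(1)}$ there is at most one $\alpha\in Q_1$ with $\alpha\beta$ a path not in $Z^{(1)}$ and at most one $\gamma\in Q_1$ with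 $\beta\gamma$ a path not in $Z^{(1)}$; (FG3) for each $\beta\in Q_1^{(1)}$ there is at most one $\alpha\in Q_1$ with $\alpha\beta\in Z^{(1)}$ and at most one $\gamma\in Q_1$ with $\beta\gamma\in Z^{(1)}$; (FG4) all elements of $Z^{(1)}$ have length $2$; (FG5) each $x^2-\lambda_{v,1}x-\lambda_{v,2}$ is irreducible over $K$. It is assumed that $Q_0^{(2)}\neq\emptyset$ (if $Q_0^{(2)}=\emptyset$ one has a gentle pair $(Q,Z)$ and a gentle algebra $KQ/\langle Z\rangle$). The folded gentle algebra is $A=KQ/\langle Z\rangle$. Unfolding procedure: $\widehat Q$ has two vertices $\widehat v,\widehat v'$ for each ordinary vertex $v$, one vertex $\widehat v=\widehat v'$ for each crease vertex $v$, and two arrows $\widehat\alpha\colon\widehat u\to\widehat v$, $\widehat\alpha'\colon\widehat u'\to\widehat v'$ for each ordinary arrow $\alpha\colon u\to v$; $\widehat Z=\{\widehat\alpha\widehat\beta,\widehat\alpha'\widehat\beta' : \alpha\beta\in Z^{(1)}\}$; $\widehat A=K\widehat Q/\langle\widehat Z\rangle$ (a gentle algebra without crease vertices). $\mathbb Z_2=\{1,g\}$ acts by $g\widehat v=\widehat v'$, $g\widehat\alpha=\widehat\alpha'$, and on words symbolwise, $g(\widehat\sigma_1\cdots\widehat\sigma_n)=(g\widehat\sigma_1)\cdots(g\widehat\sigma_n)$ with $g\widehat\alpha^{-1}=(g\widehat\alpha)^{-1}$. Words: symbols are arrows $\alpha$ and formal inverses $\alpha^{-1}$ with $s(\alpha^{-1})=t(\alpha)$,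 $t(\alpha^{-1})=s(\alpha)$; $\eta_v^{\pm1}$ are crease symbols, all others are ordinary. A word is a sequence $\sigma_1\cdots\sigma_n$ of symbols with $t(\sigma_i)=s(\sigma_{i+1})$, or a simple word $\varepsilon_v$ of length $0$ ($\varepsilon_v^{-1}=\varepsilon_v$); $w^{-1}=\sigma_n^{-1}\cdots\sigma_1^{-1}$; $w$ is reduced if $\sigma_i\ne\sigma_{i+1}^{-1}$ for all $i$; concatenations are identified with their reductions. A string is a word $w$ with (S1) $w$ reduced; (S2) no subword $w'$ with $w'\in Z^{(1)}$ or $(w')^{-1}\in Z^{(1)}$, and no proper power of a crease symbol in $w$; (S3) $s(w)\in Q_0^{(2)}$ iff $w$ starts with a crease symbol, and $t(w)\in Q_0^{(2)}$ iff $w$ ends with a crease symbol. A band is a word $w$ with (B1) $w$ is neither a simple word nor a crease symbol; (B2) $w$ is cyclic ($s(w)=t(w)$) and all powers of $w$ satisfy (S1) and (S2); (B3) there is no proper subword $w'$ with $w\approx(w')^k$, $k>0$. Relations: $w\sim_1w'$ iff $w'\in\{w,w^{-1}\}$; $w\sim_2w'$ iff they agree after identifying $\eta_v=\eta_v^{-1}$ for all crease loops; for bands $w\sim_3w'$ iff they agree up to cyclic rotation. For words/strings $w\approx w'$ iff $w\sim_1w''\sim_2w'$ for some $w''$; for bands $w\approx w'$ iff $w\sim_1w''\sim_2w'''\sim_3w'$ for some bands $w'',w'''$. Elements of $\mathcal S,\mathcal B$ are denoted by representatives. A non-simple string is symmetric if $w\sim_2w^{-1}$; simple strings are never symmetric;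 a band $w$ is symmetric if there is a band $w'$ with $w\sim_2w'\sim_3w^{-1}$; otherwise asymmetric. A string or band $\widehat w$ of $\widehat A$ is $\mathbb Z_2$-invariant if $g\widehat w\approx\widehat w$. The same definitions apply to $\widehat A$ (with no crease symbols). *)

(* Defs.v *)
From mathcomp Require Import all_boot all_order all_algebra all_fingroup.
From mathcomp Require Import boolp classical_sets.
From mathcomp Require Import finmap monalg.

Set Implicit Arguments.
Unset Strict Implicit.
Unset Printing Implicit Defensive.

Import GRing.Theory.

Local Open Scope ring_scope.

(** * Triples (K, Q, Z) *)

(* [oarrow] is Q_1^(1).  The crease loops are not separate data: Q_1^(2) is
   indexed by the crease vertices, so Q_1 = Q_1^(1) + {v | crease v} and
   [inr v] is the loop eta_v.  [Z1] is Z^(1), a set of paths given as lists of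
   arrows; [lam1 v] and [lam2 v] are the coefficients of the element
   eta_v^2 - lam1 v eta_v - lam2 v epsilon_v of Z^(2).  No condition on Z^(1)
   is part of the record: see [folded_gentle]. *)
Record triple (K : fieldType) := Triple {
  vertex : finType;
  crease : pred vertex;
  oarrow : finType;
  osrc : oarrow -> vertex;
  otgt : oarrow -> vertex;
  Z1 : pred (seq (oarrow + {v : vertex | crease v}));
  lam1 : {v : vertex | crease v} -> K;
  lam2 : {v : vertex | crease v} -> K
}.

Arguments crease {K} t v.
Arguments osrc {K} t a.
Arguments otgt {K} t a.
Arguments Z1 {K} t p.
Arguments lam1 {K} t v.
Arguments lam2 {K} t v.

Definition cvertex {K : fieldType} (A : triple K) : finType :=
  {v : vertex A | crease A v}.

Definition arrow {K : fieldType} (A : triple K) : finType :=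
  (oarrow A + cvertex A)%type.

Definition asrc {K : fieldType} (A : triple K) (a : arrow A) : vertex A :=
  match a with inl b => osrc A b | inr v => val v end.

Definition atgt {K : fieldType} (A : triple K) (a : arrow A) : vertex A :=
  match a with inl b => otgt A b | inr v => val v end.

Definition is_eta {K : fieldType} (A : triple K) (a : arrow A) : bool :=
  if a is inr _ then true else false.

(* [ends_at v s]: the end vertex of the list of arrows [s] starting at [v];
   the start vertex is only relevant for the empty list (stationary path). *)
Definition ends_at {K : fieldType} (A : triple K) (v : vertex A)
  (s : seq (arrow A)) : vertex A := last v [seq atgt a | a <- s].

Fixpoint is_path {K : fieldType} (A : triple K) (v : vertex A)
    (s : seq (arrow A)) : bool :=
  if s is a :: s' then (asrc a == v) && is_path (atgt a) s' else true.

(** * Folded gentle triples *)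

Record folded_gentle (K : fieldType) (A : triple K) : Prop := FoldedGentle {
  fg_crease : exists v, crease A v;
  fg_Z1 : forall p, Z1 A p ->
    [/\ exists v, is_path v p, (2 <= size p)%N
      & all (fun a => ~~ is_eta a) (p : seq (arrow A))];
  fg1 : forall v : vertex A,
    (#|[set a : arrow A | asrc a == v]| <= 2)%N /\
    (#|[set a : arrow A | atgt a == v]| <= 2)%N;
  fg2 : forall b : oarrow A,
    (#|[set a : arrow A | (atgt a == osrc A b)
                          && ~~ Z1 A [:: a; inl b]]| <= 1)%N /\
    (#|[set c : arrow A | (asrc c == otgt A b)
                          && ~~ Z1 A [:: inl b; c]]| <= 1)%N;
  fg3 : forall b : oarrow A,
    (#|[set a : arrow A | Z1 A [:: a; inl b]]| <= 1)%N /\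
    (#|[set c : arrow A | Z1 A [:: inl b; c]]| <= 1)%N;
  fg4 : forall p, Z1 A p -> size p = 2;
  fg5 : forall v : cvertex A,
    irreducible_poly ('X^2 - lam1 A v *: 'X - (lam2 A v)%:P)
}.

(** * The algebra KQ/<Z> *)

(* A path of Q: its source together with its list of arrows. *)
Definition qpath {K : fieldType} (A : triple K) :=
  {p : vertex A * seq (arrow A) | is_path p.1 p.2}.

Definition psrc {K : fieldType} (A : triple K) (p : qpath A) : vertex A :=
  (val p).1.
Definition parr {K : fieldType} (A : triple K) (p : qpath A) :
  seq (arrow A) := (val p).2.
Definition ptgt {K : fieldType} (A : triple K) (p : qpath A) : vertex A :=
  ends_at (psrc p) (parr p).

Definition KQ {K : fieldType} (A : triple K) := {malg K[qpath A]}.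

Definition pelt {K : fieldType} (A : triple K) (c : K) (p : qpath A) : KQ A :=
  << c *g p >>.

(* Concatenation of composable paths; [insubd] needs a default value, which is
   never used when [ptgt p = psrc q], see [val_qcat]. *)
Definition qcat {K : fieldType} (A : triple K) (p q : qpath A) : qpath A :=
  insubd p (psrc p, parr p ++ parr q).

Lemma val_qcat (K : fieldType) (A : triple K) (p q : qpath A) :
  ptgt p = psrc q -> val (qcat p q) = (psrc p, parr p ++ parr q).
Proof.
move=> pq; rewrite val_insubd; case: ifP => // /negP[] /=.
case: p q pq => -[v s] /= ps [[u t] /= pt]; rewrite /ptgt /psrc /parr /=.
elim: s v ps => [|a s IHs] v /=; first by move=> _; rewrite /ends_at /= => ->.
by case/andP=> -> /IHs.
Qed.

(* Bilinear extension of concatenation; non-composable paths multiply to 0. *)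
Definition KQmul {K : fieldType} (A : triple K) (x y : KQ A) : KQ A :=
  \sum_(p <- enum_fset (msupp x)) \sum_(q <- enum_fset (msupp y))
    (if ptgt p == psrc q then pelt (x@_p * y@_q) (qcat p q) else 0).

Fact eta_pow_path (K : fieldType) (A : triple K) (v : cvertex A) (n : nat) :
  is_path (val v) (nseq n (inr v : arrow A)).
Proof. by elim: n => //= n ->; rewrite eqxx. Qed.

(* eta_v^n; it is the stationary path at v for n = 0. *)
Definition eta_pow {K : fieldType} (A : triple K) (v : cvertex A) (n : nat) :
  qpath A :=
  exist _ (val v, nseq n (inr v : arrow A)) (eta_pow_path v n).

Definition Zset {K : fieldType} (A : triple K) (x : KQ A) : Prop :=
  (exists2 p : qpath A, Z1 A (parr p) & x = pelt 1 p) \/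
  (exists v : cvertex A,
     x = pelt 1 (eta_pow v 2) - lam1 A v *: pelt 1 (eta_pow v 1)
         - lam2 A v *: pelt 1 (eta_pow v 0)).

(* The two-sided ideal <Z> of KQ. *)
Inductive Zideal {K : fieldType} (A : triple K) : KQ A -> Prop :=
| Zideal_gen x : Zset x -> Zideal x
| Zideal_0 : Zideal 0
| Zideal_add x y : Zideal x -> Zideal y -> Zideal (x + y)
| Zideal_mull a x : Zideal x -> Zideal (KQmul a x)
| Zideal_mulr a x : Zideal x -> Zideal (KQmul x a).

(* KQ/<Z> is spanned over K by the classes of finitely many elements. *)
Definition finite_dimensional (K : fieldType) (A : triple K) : Prop :=
  exists (n : nat) (b : 'I_n -> KQ A), forall x : KQ A,
    exists c : 'I_n -> K, Zideal (x - \sum_(i < n) c i *: b i).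

(** * Words *)

(* [(a, false)] is the arrow a and [(a, true)] its formal inverse. *)
Definition symbol {K : fieldType} (A : triple K) : finType :=
  (arrow A * bool)%type.

Definition sinv {K : fieldType} (A : triple K) (x : symbol A) : symbol A :=
  (x.1, ~~ x.2).
Definition ssrc {K : fieldType} (A : triple K) (x : symbol A) : vertex A :=
  if x.2 then atgt x.1 else asrc x.1.
Definition stgt {K : fieldType} (A : triple K) (x : symbol A) : vertex A :=
  if x.2 then asrc x.1 else atgt x.1.
Definition crease_symbol {K : fieldType} (A : triple K) (x : symbol A) : bool :=
  is_eta x.1.

(* As for paths, a word is recorded with its source: (v, [::]) is the simple
   word epsilon_v.  Composability is imposed by [is_word]. *)
Definition word {K : fieldType} (A : triple K) : Type :=
  (vertex A * seq (symbol A))%type.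

Definition wsrc {K : fieldType} (A : triple K) (w : word A) : vertex A := w.1.
Definition wtgt {K : fieldType} (A : triple K) (w : word A) : vertex A :=
  last w.1 [seq stgt x | x <- w.2].

Fixpoint is_walk {K : fieldType} (A : triple K) (v : vertex A)
    (s : seq (symbol A)) : bool :=
  if s is x :: s' then (ssrc x == v) && is_walk (stgt x) s' else true.

Definition is_word {K : fieldType} (A : triple K) (w : word A) : bool :=
  is_walk w.1 w.2.

Definition simple {K : fieldType} (A : triple K) (w : word A) : Prop :=
  w.2 = [::].

Definition winv {K : fieldType} (A : triple K) (w : word A) : word A :=
  (wtgt w, rev [seq sinv x | x <- w.2]).

Definition reduced {K : fieldType} (A : triple K) (w : word A) : bool :=
  sorted (fun x y => x != sinv y) w.2.

(* Cancels the factors x x^-1. *)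
Definition reduction {K : fieldType} (A : triple K) (w : word A) : word A :=
  (w.1, foldr (fun x s => if s is y :: s' then
                            if x == sinv y then s' else x :: s
                          else [:: x]) [::] w.2).

(* Concatenations are identified with their reductions. *)
Definition wcat {K : fieldType} (A : triple K) (w w' : word A) : word A :=
  reduction (w.1, w.2 ++ w'.2).

(* The power w^k as a sequence of symbols, before any reduction. *)
Definition wpow {K : fieldType} (A : triple K) (w : word A) (k : nat) : word A :=
  (w.1, flatten (nseq k w.2)).

Definition wrot {K : fieldType} (A : triple K) (n : nat) (w : word A) : word A :=
  (wtgt (w.1, take n w.2), rot n w.2).

Definition subword {K : fieldType} (A : triple K) (u w : word A) : Prop :=
  exists p q, w.2 = p ++ u.2 ++ q /\ u.1 = wtgt (w.1, p).

Definition in_Z1 {K : fieldType} (A : triple K) (w : word A) : Prop :=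
  exists2 p, Z1 A p & w.2 = [seq (a, false) | a <- (p : seq (arrow A))].

Definition ncrease {K : fieldType} (A : triple K) (w : word A) : nat :=
  count (@crease_symbol K A) w.2.

(** * Equivalences of words *)

Definition sim1 {K : fieldType} (A : triple K) (w w' : word A) : Prop :=
  w' = w \/ w' = winv w.

(* Identifies eta_v and eta_v^-1. *)
Definition forget_sign {K : fieldType} (A : triple K) (x : symbol A) :
  symbol A := if crease_symbol x then (x.1, false) else x.

Definition sim2 {K : fieldType} (A : triple K) (w w' : word A) : Prop :=
  w.1 = w'.1 /\
  [seq forget_sign x | x <- w.2] = [seq forget_sign x | x <- w'.2].

Definition sim3 {K : fieldType} (A : triple K) (w w' : word A) : Prop :=
  exists n, w' = wrot n w.

Definition word_equiv {K : fieldType} (A : triple K) (w w' : word A) : Prop :=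
  exists w1, sim1 w w1 /\ sim2 w1 w'.

(** * Strings and bands *)

Definition S1 {K : fieldType} (A : triple K) (w : word A) : Prop := reduced w.

Definition S2 {K : fieldType} (A : triple K) (w : word A) : Prop :=
  (forall u, subword u w -> ~ in_Z1 u /\ ~ in_Z1 (winv u)) /\
  (forall u x k, crease_symbol x -> (2 <= k)%N -> subword u w ->
     u.2 <> nseq k x).

Definition S3 {K : fieldType} (A : triple K) (w : word A) : Prop :=
  crease A (wsrc w) = head false [seq crease_symbol x | x <- w.2] /\
  crease A (wtgt w) = last false [seq crease_symbol x | x <- w.2].

Definition is_string {K : fieldType} (A : triple K) (w : word A) : Prop :=
  [/\ is_word w, S1 w, S2 w & S3 w].

Definition B1 {K : fieldType} (A : triple K) (w : word A) : Prop :=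
  ~ simple w /\ (forall x, crease_symbol x -> w.2 <> [:: x]).

(* The powers are not reduced here, otherwise (S1) would be void for them. *)
Definition B2 {K : fieldType} (A : triple K) (w : word A) : Prop :=
  wsrc w = wtgt w /\ (forall k, S1 (wpow w k) /\ S2 (wpow w k)).

Definition B3 {K : fieldType} (A : triple K) (w : word A) : Prop :=
  forall u k, subword u w -> u <> w -> wsrc u = wtgt u -> (0 < k)%N ->
    ~ word_equiv w (reduction (wpow u k)).

Definition is_band {K : fieldType} (A : triple K) (w : word A) : Prop :=
  [/\ is_word w, B1 w, B2 w & B3 w].

Definition band_equiv {K : fieldType} (A : triple K) (w w' : word A) : Prop :=
  exists w1 w2, [/\ is_band w1, is_band w2, sim1 w w1, sim2 w1 w2 & sim3 w2 w'].

Definition symmetric_string {K : fieldType} (A : triple K) (w : word A) : Prop :=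
  ~ simple w /\ sim2 w (winv w).

Definition symmetric_band {K : fieldType} (A : triple K) (w : word A) : Prop :=
  exists w', [/\ is_band w', sim2 w w' & sim3 w' (winv w)].

Record gstring {K : fieldType} (A : triple K) := GString {
  string_word :> word A;
  stringP : is_string string_word
}.

Record gband {K : fieldType} (A : triple K) := GBand {
  band_word :> word A;
  bandP : is_band band_word
}.

(** * Quotients *)

(* T/R as the set of classes {y | R x y}, for R an equivalence relation. *)
Definition quotient (T : Type) (R : T -> T -> Prop) : Type :=
  {C : set T | exists x : T, C = [set y | R x y]%classic}.

Definition class_of (T : Type) (R : T -> T -> Prop) (x : T) : quotient R :=
  exist _ [set y | R x y]%classic (ex_intro _ x erefl).

Arguments class_of {T} R x.

Definition string_rel {K : fieldType} (A : triple K) (w w' : gstring A) : Prop :=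
  word_equiv w w'.
Definition band_rel {K : fieldType} (A : triple K) (w w' : gband A) : Prop :=
  band_equiv w w'.

Definition strings {K : fieldType} (A : triple K) : Type :=
  quotient (@string_rel K A).
Definition bands {K : fieldType} (A : triple K) : Type :=
  quotient (@band_rel K A).

Definition string_class {K : fieldType} (A : triple K) (w : gstring A) :
  strings A := class_of (@string_rel K A) w.
Definition band_class {K : fieldType} (A : triple K) (w : gband A) :
  bands A := class_of (@band_rel K A) w.

Definition orbit_rel {T : Type} (act : {action 'Z_2 &-> T}) (x y : T) : Prop :=
  exists a : 'Z_2, y = act x a.

Definition orbits {T : Type} (act : {action 'Z_2 &-> T}) : Type :=
  quotient (orbit_rel act).

Definition orbit_of {T : Type} (act : {action 'Z_2 &-> T}) (x : T) :
  orbits act := class_of (orbit_rel act) x.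

Definition surjective_fun (T U : Type) (f : T -> U) : Prop :=
  forall y, exists x, f x = y.

(* The generator of Z_2, whose group law is addition mod 2. *)
Definition Z2gen : 'Z_2 := 1%R.

(** * Unfolding *)

(* The vertex (v, b) lies on sheet [b]; a crease vertex is on sheet [false]
   only.  [hatv v false] and [hatv v true] are the two vertices over v, which
   coincide when v is a crease vertex. *)
Definition hat_vertex {K : fieldType} (A : triple K) : finType :=
  {x : vertex A * bool | ~~ (crease A x.1 && x.2)}.

Fact hatv_subproof (K : fieldType) (A : triple K) (v : vertex A) (b : bool) :
  ~~ (crease A v && (~~ crease A v && b)).
Proof. by case: (crease A v). Qed.

Definition hatv {K : fieldType} (A : triple K) (v : vertex A) (b : bool) :
  hat_vertex A := exist _ (v, ~~ crease A v && b) (hatv_subproof v b).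

Definition hat_oarrow {K : fieldType} (A : triple K) : finType :=
  (oarrow A * bool)%type.

Definition hat_crease {K : fieldType} (A : triple K) : pred (hat_vertex A) :=
  fun=> false.

Definition hat_Z1 {K : fieldType} (A : triple K) :
    pred (seq (hat_oarrow A + {x : hat_vertex A | hat_crease x})) :=
  fun p => match p with
           | [:: inl (a, i); inl (b, j)] =>
               (i == j) && Z1 A [:: inl a; inl b]
           | _ => false
           end.

Definition unfolding (K : fieldType) (A : triple K) : triple K :=
  @Triple K (hat_vertex A) (@hat_crease K A) (hat_oarrow A)
    (fun a => hatv (osrc A a.1) a.2) (fun a => hatv (otgt A a.1) a.2)
    (@hat_Z1 K A) (fun=> 0) (fun=> 0).

Definition gvertex {K : fieldType} (A : triple K) (x : vertex (unfolding A)) :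
  vertex (unfolding A) :=
  let: (v, b) := val (x : hat_vertex A) in hatv v (~~ b).

(* There are no crease loops in the unfolding; the second case never occurs. *)
Definition garrow {K : fieldType} (A : triple K) (x : arrow (unfolding A)) :
  arrow (unfolding A) :=
  match x with inl a => inl (a.1, ~~ a.2) | inr v => inr v end.

Definition gsymbol {K : fieldType} (A : triple K) (x : symbol (unfolding A)) :
  symbol (unfolding A) := (garrow x.1, x.2).

Definition gword {K : fieldType} (A : triple K) (w : word (unfolding A)) :
  word (unfolding A) := (gvertex w.1, [seq gsymbol x | x <- w.2]).

Definition invariant_string {K : fieldType} (A : triple K)
  (w : word (unfolding A)) : Prop := word_equiv (gword w) w.
Definition invariant_band {K : fieldType} (A : triple K)
  (w : word (unfolding A)) : Prop := band_equiv (gword w) w.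

(* Main.v *)
Require Import Defs.
From mathcomp Require Import all_boot all_order all_algebra all_fingroup.
From mathcomp Require Import boolp classical_sets.

(** Crease symbols carry no information beyond their position: at a crease vertex
    the crease loop takes one of the two places for arrows in each direction, and
    the composite of the remaining ordinary arrows is a relation, so a string or
    band that arrives at or leaves such a vertex by an ordinary symbol must have
    a crease symbol there (crease_not_allowed, and (S3) at the ends of a string).
    Up to signs of crease symbols, a string or band is thus determined by its
    core, the word of its ordinary symbols (expand_core, string_sim2,
    cyc_unsigned_core).

    In the unfolding, the same two relations force every word that passes through
    a crease vertex to change sheets there, while at an ordinary vertex it cannot
    change sheets.  Hence the words of the unfolding are the words in pairs (x, i)
    of an ordinary symbol and a sheet whose sheets are determined by the first one
    and by the crease vertices met (follows_of_cover): they form a double cover of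
    the words of ordinary symbols, with g as deck transformation.

    For strings, the two lifts of a core are exchanged by g, and inversion of the
    lift covers inversion of the core.  So folding identifies exactly the orbits
    of g, and a core equal to its inverse lifts to a word whose inverse is one of
    the two lifts; it is the other one, since a reduced nonempty word is not its
    own inverse (fold_string_fiber, invariant_string_down).

    For bands, a core s lifts to a closed word if and only if it meets an even
    number of crease vertices.  If this number is odd, s has to be traversed twice,
    and the lift is a word u preceded by gu.  In both cases the lift is primitive,
    and every primitive closed word of the cover arises in this way, from a core
    that is determined by the uniqueness of primitive roots (band_of_cover,
    cover_of_band, cover_ceq).  If a cyclic word is its own inverse, the axes of
    this reflection pass between letters, since a letter differs from its inverse;
    so the word is composed of a word p and its inverse, turning back at two crease
    vertices.  Such a core meets an even number of crease vertices, and its lift is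
    composed of a lift of p and the inverse of the other lift (reversible_mirror,
    cycle_mirror).  If conversely g rotates the lift of s, then the core cannot
    have lifted in one turn, by primitivity; and if g reverses the lift, then s is
    its own inverse (invariant_bandP). *)

Set Implicit Arguments.
Unset Strict Implicit.
Unset Printing Implicit Defensive.

Local Open Scope nat_scope.

Local Notation cycle := path.cycle.

(** * Cyclic words *)

Section CyclicWords.
Variable T : eqType.
Implicit Types (s t u : seq T) (e : rel T).

Definition power k s := flatten (nseq k s).

Definition cyc s t := exists n, t = rot n s.

Definition primitive s := s <> [::] /\ forall k u, s = power k u -> k = 1.

Lemma powerS k s : power k.+1 s = s ++ power k s. Proof. by []. Qed.

Lemma power1 s : power 1 s = s. Proof. exact: cats0. Qed.

Lemma power2 s : power 2 s = s ++ s. Proof. by rewrite /power /= cats0. Qed.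

Lemma power_nil k : power k [::] = [::] :> seq T.
Proof. by elim: k. Qed.

Lemma size_power k s : size (power k s) = k * size s.
Proof. by elim: k => //= k IHk; rewrite size_cat mulSn -IHk. Qed.

Lemma powerD j k s : power (j + k) s = power j s ++ power k s.
Proof. by rewrite /power nseqD flatten_cat. Qed.

Lemma power_mul j k s : power j (power k s) = power (j * k) s.
Proof. by elim: j => // j IHj; rewrite mulSn powerD -IHj. Qed.

Lemma rev_power k s : rev (power k s) = power k (rev s).
Proof.
elim: k => // k IHk.
by rewrite -addn1 powerD power1 rev_cat IHk addnC powerD power1.
Qed.

Lemma power_inj k s t : 0 < k -> power k s = power k t -> s = t.
Proof.
case: k => // k _ est.
have sz : size s = size t.
  by have /eqP := congr1 size est; rewrite !size_power eqn_mul2l => /eqP.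
by move/eqP: est; rewrite /power /= eqseq_cat // => /andP[/eqP].
Qed.

Lemma rot1_power k s : rot 1 (power k s) = power k (rot 1 s).
Proof.
case: s => [|x s]; first by rewrite (_ : rot 1 [::] = [::]) // power_nil.
rewrite rot1_cons; case: k => //= k; rewrite /power /= rot1_cons.
elim: k => [|k IHk] /=; first by rewrite !cats0.
by rewrite -IHk cat_rcons rcons_cat.
Qed.

Lemma cyc_refl s : cyc s s. Proof. by exists 0; rewrite rot0. Qed.

Lemma cycP s t : cyc s t <-> exists a b, s = a ++ b /\ t = b ++ a.
Proof.
split=> [[n ->]|[a [b [-> ->]]]]; last by exists (size a); rewrite rot_size_cat.
by exists (take n s), (drop n s); rewrite cat_take_drop.
Qed.

Lemma cyc_sym s t : cyc s t -> cyc t s.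
Proof. by move/cycP=> [a [b [-> ->]]]; apply/cycP; exists b, a. Qed.

Lemma rot_small n s : exists2 m, m <= size s & rot n s = rot m s.
Proof.
have [le_ns|/ltnW le_sn] := leqP n (size s); first by exists n.
by exists 0 => //; rewrite rot0 rot_oversize.
Qed.

Lemma cyc_trans s t u : cyc s t -> cyc t u -> cyc s u.
Proof.
move=> [n ->] [m ->].
have [n' le_n' ->] := rot_small n s; have [m' ] := rot_small m (rot n' s).
by rewrite size_rot => le_m' ->; rewrite rot_add_mod //; eexists.
Qed.

Lemma cyc_size s t : cyc s t -> size t = size s.
Proof. by case=> n ->; rewrite size_rot. Qed.

Lemma cyc_rot n s : cyc s (rot n s). Proof. by exists n. Qed.

Lemma cyc_rev s t : cyc s t -> cyc (rev s) (rev t).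
Proof.
move/cycP=> [a [b [-> ->]]]; apply/cycP.
by exists (rev b), (rev a); rewrite !rev_cat.
Qed.

Lemma cyc_cycle e s t : cyc s t -> cycle e t = cycle e s.
Proof. by case=> n ->; rewrite rot_cycle. Qed.

Lemma rot_iter n s : n <= size s -> rot n s = iter n (rot 1) s.
Proof. by elim: n => [|n IHn] lt_ns; rewrite ?rot0 // rotS // IHn // ltnW. Qed.

(** One-letter rotations generate all the others, so that they are enough to
    transport a property of words to cyclic words. *)
Lemma cyc_ind (P : seq T -> Prop) s t :
  (forall u, P u -> P (rot 1 u)) -> cyc s t -> P s -> P t.
Proof.
move=> P1 [n ->] Ps; have [m le_m ->] := rot_small n s.
by rewrite rot_iter //; elim: {le_m} m => //= m; apply: P1.
Qed.

Lemma cyc_power k s t : cyc s t -> cyc (power k s) (power k t).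
Proof.
move=> st; pose P u := cyc (power k s) (power k u).
apply: (@cyc_ind P _ _ _ st (cyc_refl _)) => u /cyc_trans; apply.
by rewrite -rot1_power; apply: cyc_rot.
Qed.

Lemma cyc_power_inv k s t : cyc (power k s) t -> exists2 u, cyc s u & t = power k u.
Proof.
pose P v := exists2 u, cyc s u & v = power k u.
move=> st; apply: (@cyc_ind P _ _ _ st); last by exists s; first exact: cyc_refl.
move=> _ [u su ->]; exists (rot 1 u); last by rewrite rot1_power.
exact: cyc_trans su (cyc_rot _ _).
Qed.

Lemma primitive_cyc s t : cyc s t -> primitive s -> primitive t.
Proof.
move=> st [s0 ps]; split=> [t0|k u tu].
  by apply: s0; apply: size0nil; rewrite -(cyc_size st) t0.
have [v _ /ps //] : exists2 v, cyc u v & s = power k v.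
by apply: cyc_power_inv; rewrite -tu; apply: cyc_sym.
Qed.

Lemma cycle_power e k s : 0 < k -> cycle e (power k s) = cycle e s.
Proof.
case: k => // k _; case: s => [|x s]; first by rewrite power_nil.
rewrite /power /=; elim: k => [|k IHk] /=; first by rewrite cats0.
by rewrite rcons_cat cat_path /= IHk rcons_path; case: path; rewrite ?andbb.
Qed.

Lemma sorted_square e s : sorted e (s ++ s) -> cycle e s.
Proof.
case: s => //= x s; rewrite cat_path /= rcons_path.
by case/andP=> -> /andP[->].
Qed.

Lemma sorted_power e s k : cycle e s -> sorted e (power k s).
Proof.
case: k => // k; rewrite -(@cycle_power e k.+1) //.
by case: (power _ _) => //= x t; rewrite rcons_path => /andP[].
Qed.

(** Commuting words are powers of a common word. *)
Lemma catC_power s t : s ++ t = t ++ s ->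
  exists u j k, s = power j u /\ t = power k u.
Proof.
have [n] := ubnP (size s + size t); elim: n s t => // n IHn.
suff IH s t : size s <= size t -> size s + size t <= n -> s ++ t = t ++ s ->
    exists u j k, s = power j u /\ t = power k u.
  move=> s t; rewrite ltnS; have [/IH//|/ltnW ts] := leqP (size s) (size t).
  rewrite addnC => le_n st.
  by have [u [j [k [-> ->]]]] := IH t s ts le_n (esym st); exists u, k, j.
case: s => [|x s] le_st le_n st.
  by exists t, 0, 1; rewrite power1.
have def_t : t = (x :: s) ++ drop (size (x :: s)) t.
  have := congr1 (take (size (x :: s))) st.
  by rewrite take_size_cat // takel_cat // => {1}->; rewrite cat_take_drop.
move: (drop _ t) def_t => t' def_t; rewrite {}def_t in st le_n {le_st} *.
have [||u [j [k [-> ->]]]] := IHn (x :: s) t'.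
- apply: leq_trans le_n; rewrite size_cat ltn_add2l.
  by rewrite -[X in X < _]add0n ltn_add2r.
- by move/eqP: st; rewrite -catA eqseq_cat // => /andP[_ /eqP].
by exists u, j, (j + k); rewrite powerD.
Qed.

(** If a rotation fixes s, the two parts that it exchanges commute. *)
Lemma primitive_rot s n : primitive s -> n < size s -> rot n s = s -> n = 0.
Proof.
move=> [_ ps] lt_n fix_s; have := cat_take_drop n s.
have /catC_power[u [j [k [ej ek]]]] : take n s ++ drop n s = drop n s ++ take n s.
  by rewrite cat_take_drop -[LHS]fix_s.
rewrite ej ek -powerD => /esym/ps ejk.
have sj : size (take n s) = n by rewrite size_take lt_n.
have sk : size (drop n s) = size s - n by rewrite size_drop.
case: j ej ejk => [|[|//]] ej; first by rewrite -sj ej.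
by rewrite add1n => -[k0]; move: sk lt_n; rewrite ek k0 /= -subn_gt0 => <-.
Qed.

Lemma primitive_iter_rot s n : primitive s -> iter n (rot 1) s = s -> size s %| n.
Proof.
move=> ps fix_s; have s0 : 0 < size s by case: ps; case: (s).
apply/eqP/(primitive_rot ps); rewrite ?ltn_mod // rot_iter ?(ltnW (ltn_pmod _ _)) //.
have per k : iter (k * size s) (rot 1) s = s.
  elim: k => // k IHk; rewrite mulSn iterD IHk -rot_iter //; exact: rot_size.
by have := fix_s; rewrite {1}(divn_eq n (size s)) addnC iterD per.
Qed.

Lemma iter_rot_power n k s : iter n (rot 1) (power k s) = power k (iter n (rot 1) s).
Proof. by elim: n => //= n ->; rewrite rot1_power. Qed.

(** The length of each primitive root is a period of the common power, hence a
    multiple of the length of the other. *)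
Lemma primitive_root_unique s t j k : 0 < k ->
  primitive s -> primitive t -> power j s = power k t -> s = t /\ j = k.
Proof.
have dvd s1 t1 i l : 0 < i -> primitive s1 -> power i s1 = power l t1 ->
    size s1 %| size t1.
  move=> i0 ps st; apply: primitive_iter_rot => //; apply: (@power_inj i) => //.
  rewrite -iter_rot_power st iter_rot_power; congr power.
  by rewrite -rot_iter // rot_size.
move=> k0 ps pt st; have t0 : 0 < size t by case: pt; case: (t).
have j0 : 0 < j.
  case: j st => // st; have := congr1 size st; rewrite !size_power /= => /eqP.
  by rewrite eq_sym muln_eq0 !gtn_eqF.
have sz : size s = size t.
  by apply/eqP; rewrite eqn_dvd (dvd _ _ _ _ j0 ps st) (dvd _ _ _ _ k0 pt (esym st)).
have /eqP := congr1 size st; rewrite !size_power sz eqn_pmul2r // => /eqP jk.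
by split=> //; apply: (power_inj k0); rewrite -st jk.
Qed.

Lemma primitive_root s : s <> [::] ->
  exists u k, [/\ primitive u, 0 < k & s = power k u].
Proof.
have [n] := ubnP (size s); elim: n s => // n IHn s le_s s0.
have [ps|nps] := EM (primitive s); first by exists s, 1; rewrite power1.
have [k [u [su k1]]] : exists k u, s = power k u /\ k <> 1.
  apply: contrapT => no; apply: nps; split=> // k u su.
  by apply: contrapT => k1; apply: no; exists k, u.
have u0 : u <> [::] by move=> u0; rewrite su u0 power_nil in s0.
have k0 : 1 < k by case: k su k1 => [|[|]] // su; rewrite su in s0.
have [|v [j [pv j0 uv]]] := IHn u _ u0.
  move: le_s; rewrite ltnS; apply: leq_trans.
  rewrite su size_power -{1}(mul1n (size u)).
  by rewrite ltn_pmul2r //; case: (u) u0.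
by exists v, (k * j); rewrite -power_mul -uv muln_gt0 j0 ltnW.
Qed.

End CyclicWords.

Lemma map_power (T U : eqType) (f : T -> U) k s :
  map f (power k s) = power k (map f s).
Proof. by rewrite /power map_flatten map_nseq. Qed.

Lemma cyc_map (T U : eqType) (f : T -> U) s t : cyc s t -> cyc (map f s) (map f t).
Proof. by case=> n ->; rewrite map_rot; apply: cyc_rot. Qed.

Lemma primitive_of_map (T U : eqType) (f : T -> U) s :
  primitive (map f s) -> primitive s.
Proof.
case=> s0 ps; split=> [e|k u e]; first by apply: s0; rewrite e.
by apply: (ps k (map f u)); rewrite e map_power.
Qed.

(** * Words with inverses *)

Section Inverses.
Variables (T : eqType) (f : T -> T).
Hypothesis fK : involutive f.
Implicit Types s t u : seq T.

Definition revmap s := rev (map f s).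

Definition ceq s t := cyc s t \/ cyc (revmap s) t.

Lemma revmapK : involutive revmap.
Proof. by move=> s; rewrite /revmap map_rev revK mapK. Qed.

Lemma revmap_cat s t : revmap (s ++ t) = revmap t ++ revmap s.
Proof. by rewrite /revmap map_cat rev_cat. Qed.

Lemma revmap_power k s : revmap (power k s) = power k (revmap s).
Proof. by rewrite /revmap map_power rev_power. Qed.

Lemma size_revmap s : size (revmap s) = size s.
Proof. by rewrite size_rev size_map. Qed.

Lemma cyc_revmap s t : cyc s t -> cyc (revmap s) (revmap t).
Proof. by move=> st; apply/cyc_rev/cyc_map. Qed.

Lemma primitive_revmap s : primitive s -> primitive (revmap s).
Proof.
case=> s0 ps; split=> [e|k u e]; first by apply: s0; rewrite -(revmapK s) e.
by apply: (ps k (revmap u)); rewrite -revmap_power -e revmapK.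
Qed.

Lemma ceq_cyc s t u : ceq s t -> cyc t u -> ceq s u.
Proof. by case=> st /(cyc_trans st); [left|right]. Qed.

Lemma ceq_refl s : ceq s s. Proof. by left; apply: cyc_refl. Qed.

Lemma ceq_sym s t : ceq s t -> ceq t s.
Proof.
case=> [/cyc_sym ?|]; first by left.
by move/cyc_revmap; rewrite revmapK => /cyc_sym; right.
Qed.

Lemma ceq_trans s t u : ceq s t -> ceq t u -> ceq s u.
Proof.
move=> st [|tu]; first exact: ceq_cyc.
case: st => /cyc_revmap; first by move/cyc_trans/(_ tu); right.
by rewrite revmapK => /cyc_trans/(_ tu); left.
Qed.

(** A letter differs from its inverse, so a word that is its own inverse has
    no middle letter. *)
Lemma palindrome_split s : (forall x, f x != x) -> revmap s = s ->
  exists q, s = q ++ revmap q.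
Proof.
move=> f_neq; have [n] := ubnP (size s); elim: n s => // n IHn [|x s] /=.
  by exists [::].
case/lastP: s => [|s y]; first by move=> _ /eqP; rewrite /revmap /= eqseq_cons
  (negPf (f_neq _)).
rewrite ltnS size_rcons -rcons_cons /revmap map_rcons rev_rcons /= rev_cons.
move/ltnW=> lt_n [yx /eqP]; rewrite eqseq_rcons => /andP[/eqP es /eqP exy].
have [q eq] := IHn s lt_n es.
by exists (x :: q); rewrite eq /revmap /= rev_cons exy rcons_cat.
Qed.

(** A reflection of a cyclic word has two axes; as no axis passes through a
    letter, they cut the word into mutually inverse halves. *)
Lemma cyc_revmap_split s : (forall x, f x != x) -> cyc s (revmap s) ->
  exists p, cyc s (p ++ revmap p).
Proof.
move=> f_neq /cycP[a [b [-> /eqP]]]; rewrite revmap_cat eqseq_cat ?size_revmap //.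
case/andP=> /eqP/(palindrome_split f_neq)[p ->].
move=> /eqP/(palindrome_split f_neq)[q ->].
exists (revmap q ++ p); rewrite revmap_cat revmapK -!catA; apply/cycP.
by exists q, (revmap q ++ p ++ revmap p); rewrite -!catA.
Qed.

End Inverses.

Lemma sorted_revmap (T : eqType) (e : rel T) f (s : seq T) :
  (forall x y, e (f y) (f x) = e x y) -> sorted e (revmap f s) = sorted e s.
Proof.
by move=> ef; rewrite /revmap rev_sorted sorted_map; apply: eq_sorted => x y /=.
Qed.

Lemma cycle_revmap (T : eqType) (e : rel T) f (s : seq T) :
  (forall x y, e (f y) (f x) = e x y) -> cycle e (revmap f s) = cycle e s.
Proof.
by move=> ef; rewrite /revmap rev_cycle cycle_map; apply: eq_cycle => x y /=.
Qed.

Lemma cycle_mirrorE (T : eqType) (e : rel T) f x (p : seq T) :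
  (forall x y, e (f y) (f x) = e x y) ->
  cycle e ((x :: p) ++ revmap f (x :: p)) =
  [&& path e x p, e (last x p) (f (last x p)) & e (f x) x].
Proof.
move=> ef; rewrite /= rcons_cat cat_path.
have sp := sorted_revmap (x :: p) ef.
have lp : last x (revmap f (x :: p)) = f x.
  by rewrite /revmap /= rev_cons last_rcons.
have er : revmap f (x :: p) = f (last x p) :: revmap f (belast x p).
  by rewrite lastI /revmap map_rcons rev_rcons.
rewrite {}er /= in sp lp *.
by rewrite rcons_path sp lp; case: path; rewrite //= andbT.
Qed.

(** * Double covers *)

Section Cover.
Variables (X : eqType) (inv : X -> X) (flip : pred X) (next : rel X).
Hypothesis invK : involutive inv.
Hypothesis inv_neq : forall x, inv x != x.
Hypothesis next_inv : forall x y, next (inv y) (inv x) = next x y.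
Hypothesis flip_inv : forall x y, next x y -> flip (inv x) = flip y.
Hypothesis next_flip : forall x, next x (inv x) -> flip (inv x).

Implicit Types (s t : seq X) (w : seq (X * bool)).

Definition parity s := odd (count flip s).

(** The sheet changes on the way to the second letter exactly if this letter
    flips. *)
Definition cover_next (x y : X * bool) :=
  next x.1 y.1 && (y.2 == x.2 (+) flip y.1).

Definition cover_inv (x : X * bool) := (inv x.1, x.2).
Definition deck (x : X * bool) := (x.1, ~~ x.2).

(** The sheet i is the one before the first letter: a first letter that flips lies
    on the other sheet. *)
Fixpoint lift_word (i : bool) s :=
  if s is x :: s' then (x, i (+) flip x) :: lift_word (i (+) flip x) s' else [::].

Definition band s := cycle next s /\ primitive s.
Definition cover_band w := cycle cover_next w /\ primitive w.

(** The number of turns after which the lift of a cyclic word closes is 1 if its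
    parity is even, and 2 if it is odd. *)
Definition unroll s := power (1 + parity s) s.

Lemma cover_invK : involutive cover_inv.
Proof. by case=> x i; rewrite /cover_inv /= invK. Qed.

Lemma deckK : involutive deck.
Proof. by case=> x i; rewrite /deck /= negbK. Qed.

Lemma map_deckK : involutive (map deck).
Proof. exact: mapK deckK. Qed.

Lemma cover_next_inv x y : cover_next (cover_inv y) (cover_inv x) = cover_next x y.
Proof.
case: x y => [x i] [y j]; rewrite /cover_next /= next_inv.
by case: (boolP (next x y)) => //= /flip_inv->; case: i j (flip y) => [] [] [].
Qed.

Lemma cover_next_deck x y : cover_next (deck x) (deck y) = cover_next x y.
Proof. by rewrite /cover_next /= addNb eqb_negLR negbK. Qed.

Lemma revmap_deck w :
  revmap cover_inv (map deck w) = map deck (revmap cover_inv w).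
Proof. by rewrite /revmap map_rev -!map_comp. Qed.

Lemma fst_deck w : map fst (map deck w) = map fst w.
Proof. by rewrite -map_comp. Qed.

Lemma fst_revmap w : map fst (revmap cover_inv w) = revmap inv (map fst w).
Proof. by rewrite /revmap map_rev -!map_comp. Qed.

Lemma deck_neq w : w <> [::] -> map deck w <> w.
Proof. by case: w => [//|[x []] w] _ []. Qed.

Lemma fst_lift i s : map fst (lift_word i s) = s.
Proof. by elim: s i => //= x s IHs i; rewrite IHs. Qed.

Lemma deck_lift i s : map deck (lift_word i s) = lift_word (~~ i) s.
Proof. by elim: s i => //= x s IHs i; rewrite IHs /deck /= addNb. Qed.

Lemma parity_cat s t : parity (s ++ t) = parity s (+) parity t.
Proof. by rewrite /parity count_cat oddD. Qed.

Lemma parity_power k s : parity (power k s) = odd k && parity s.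
Proof.
elim: k => // k IHk; rewrite -[k.+1]add1n powerD parity_cat IHk power1 oddD /=.
by case: (odd k) (parity s) => [] [].
Qed.

Lemma parity_cyc s t : cyc s t -> parity t = parity s.
Proof. by move/cycP=> [a [b [-> ->]]]; rewrite !parity_cat addbC. Qed.

Lemma lift_cat i s t :
  lift_word i (s ++ t) = lift_word i s ++ lift_word (i (+) parity s) t.
Proof.
elim: s i => [|x s IHs] i /=; first by rewrite addbF.
by rewrite IHs /parity /= oddD oddb addbA.
Qed.

Lemma lift_rcons i s x :
  lift_word i (rcons s x) = rcons (lift_word i s) (x, i (+) parity s (+) flip x).
Proof. by rewrite -cats1 lift_cat cats1. Qed.

Lemma lift_power i k s : ~~ parity s ->
  lift_word i (power k s) = power k (lift_word i s).
Proof.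
move/negPf=> ps; elim: k => // k IHk.
by rewrite -add1n !powerD lift_cat !power1 ps addbF IHk.
Qed.

Lemma lift_square i s : parity s ->
  lift_word i (s ++ s) = lift_word i s ++ lift_word (~~ i) s.
Proof. by move=> ps; rewrite lift_cat ps addbT. Qed.

Lemma path_lift x i w :
  path cover_next (x, i) w =
  path next x (map fst w) && (w == lift_word i (map fst w)).
Proof.
elim: w x i => [|[y j] w IHw] x i //=; rewrite IHw eqseq_cons xpair_eqE eqxx /=.
rewrite /cover_next /=; case: next => //=.
by case: eqVneq => [->|]; rewrite ?andbF.
Qed.

Lemma sorted_lift i s : sorted cover_next (lift_word i s) = sorted next s.
Proof. by case: s => //= x s; rewrite path_lift fst_lift eqxx andbT. Qed.

Lemma sorted_cover w :
  sorted cover_next w ->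
  sorted next (map fst w) /\ exists i, w = lift_word i (map fst w).
Proof.
case: w => [|[x i] w] /=; first by split=> //; exists false.
rewrite path_lift => /andP[-> /eqP {1}->]; split=> //.
by exists (i (+) flip x); rewrite -addbA addbb addbF.
Qed.

(** The sheet reached after a word is given by its parity, so that a closed
    word of the cover is a lift_word of a closed word of even parity. *)
Lemma cycle_cover w : cycle cover_next w <->
  [/\ cycle next (map fst w), ~~ parity (map fst w) &
      exists i, w = lift_word i (map fst w)].
Proof.
case: w => [|[x i] w]; first by split=> // _; split=> //; exists false.
rewrite /= path_lift map_rcons /= lift_rcons eqseq_rcons.
rewrite xpair_eqE eqxx /=; set s := map fst w.
have -> : parity (x :: s) = parity s (+) flip x.
  by rewrite /parity /= oddD oddb addbC.
split=> [/and3P[-> /eqP ew /eqP ei]|[-> ps [j [ei {1}->]]]].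
  split=> //; first by move: ei; case: i {ew} (parity s) (flip x) => [] [] [].
  by exists (i (+) flip x); rewrite -addbA addbb addbF -ew.
rewrite ei eqxx /=.
by case: j (parity s) (flip x) ps {ei} => [] [] [].
Qed.

Lemma cover_fst_eq w w' : cycle cover_next w -> cycle cover_next w' ->
  map fst w = map fst w' -> w' = w \/ w' = map deck w.
Proof.
case/cycle_cover=> _ _ [i ->] /cycle_cover[_ _ [j ->]]; rewrite !fst_lift => ->.
have [->|ij] := eqVneq j i; first by left.
by right; rewrite deck_lift; congr lift_word; case: i j ij => [] [].
Qed.

Lemma parity_unroll s : ~~ parity (unroll s).
Proof. by rewrite parity_power oddD; case: parity. Qed.

Lemma unroll_eq s t : primitive s -> primitive t -> unroll s = unroll t -> s = t.
Proof. by move=> ps pt /(primitive_root_unique _ ps pt)[]. Qed.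

Lemma unroll_cyc s t : cyc s t -> cyc (unroll s) (unroll t).
Proof. by move=> st; rewrite /unroll (parity_cyc st); apply: cyc_power. Qed.

Lemma cyc_unroll s t : primitive s -> primitive t ->
  cyc (unroll s) (unroll t) -> cyc s t.
Proof.
move=> ps pt /cyc_power_inv[u su] /(primitive_root_unique _ pt)[] //.
  exact: primitive_cyc su ps.
by move->.
Qed.

(** The letters of the inverse flip where those of s arrive, which is where the
    next letter of s starts. *)
Lemma parity_revmap s : cycle next s -> parity (revmap inv s) = parity s.
Proof.
case: s => // x s.
have e y p : path next y p -> count (flip \o inv) (belast y p) = count flip p.
  elim: p y => //= z p IHp y /andP[yz /IHp->]; by rewrite (flip_inv yz).
move/e; rewrite belast_rcons => e1; rewrite /parity /revmap count_rev count_map.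
by congr odd; rewrite [LHS]e1 -cats1 count_cat /= addn0 addnC.
Qed.

Lemma unroll_revmap s : cycle next s -> unroll (revmap inv s) = revmap inv (unroll s).
Proof. by move=> cs; rewrite /unroll parity_revmap // revmap_power. Qed.

Lemma band_revmap s : band s -> band (revmap inv s).
Proof.
by case=> cs ps; split; [rewrite cycle_revmap | apply: primitive_revmap].
Qed.

Lemma band_cyc s t : cyc s t -> band s -> band t.
Proof.
by move=> st [cs ps]; split; [rewrite (cyc_cycle _ st) | apply: primitive_cyc ps].
Qed.

Lemma cover_band_deck w : cover_band w -> cover_band (map deck w).
Proof.
case=> cw pw; split.
  rewrite cycle_map; apply: etrans cw; apply: eq_cycle => x y.
  exact: cover_next_deck.
by apply: (@primitive_of_map _ _ deck); rewrite map_deckK.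
Qed.

(** The primitive root of the projection of a primitive word has exponent 1 if
    its parity is even, and 2 if it is odd: an even root lifts to a root of the
    given word, and so does the square of an odd root. *)
Lemma band_of_cover w : cover_band w -> exists2 s, band s & map fst w = unroll s.
Proof.
case=> /cycle_cover[cs ps [i ew]] pw; have s0 : map fst w <> [::].
  by case: pw => + _; case: (w).
have [s [k [prs k0 es]]] := primitive_root s0.
exists s; first by split=> //; move: cs; rewrite es cycle_power.
have [_ pw1] := pw; rewrite es; move: ps; rewrite es parity_power.
rewrite /unroll; have [odd_s|even_s] := boolP (parity s).
  rewrite andbT => even_k; have ek : k = k./2 * 2.
    by rewrite muln2 -[LHS]odd_double_half (negPf even_k).
  rewrite {}ek in es *; congr (power _ s).
  by rewrite (pw1 k./2 (lift_word i (power 2 s))) // -lift_power ?parity_power //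
    power_mul -es.
move=> _; congr (power _ s); apply: (pw1 k (lift_word i s)).
by rewrite -lift_power // -es.
Qed.

(** By uniqueness of primitive roots, a root of the lift projects to s or to its
    square.  An odd core does not allow the first case, because the two halves of
    its lift differ by the deck transformation. *)
Lemma cover_of_band i s : band s -> cover_band (lift_word i (unroll s)).
Proof.
case=> cs ps; split.
  apply/cycle_cover; rewrite fst_lift cycle_power // parity_unroll; split=> //.
  by exists i.
have [s0 _] := ps; split=> [|k u eu].
  move/(congr1 (map fst)); rewrite fst_lift /unroll.
  by case: parity; rewrite ?power1 ?power2; case: (s) s0.
have := congr1 (map fst) eu; rewrite fst_lift map_power.
have u0 : map fst u <> [::].
  case: u eu => // /(congr1 size); rewrite power_nil /= -(size_map fst) fst_lift.
  by rewrite size_power add1n mulSn; case: (s) s0.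
have [t [j [pt j0 ->]]] := primitive_root u0.
rewrite power_mul => /esym e.
have [ts kj] := primitive_root_unique (ltn0Sn _) pt ps e.
have [odd_s|even_s] := boolP (parity s); last first.
  by move: kj; rewrite (negPf even_s) => /eqP; rewrite muln_eq1 => /andP[/eqP].
have {j pt j0 e ts kj} le_k : k <= 2.
  by move: kj; rewrite odd_s => <-; rewrite leq_pmulr.
move: eu; rewrite /unroll odd_s power2 lift_square //.
case: k le_k => [|[//|[_|//]]]; first by case: (s) s0.
rewrite power2 => eu; have sz : size s = size u.
  have /eqP := congr1 size eu; rewrite !size_cat.
  rewrite -!(size_map fst (lift_word _ _)) !fst_lift.
  by rewrite !addnn -!muln2 eqn_pmul2r // => /eqP.
move/eqP: eu; rewrite eqseq_cat -?(size_map fst (lift_word _ _)) ?fst_lift //.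
case/andP=> /eqP <-; rewrite -deck_lift => /eqP/deck_neq[].
by case: (s) s0.
Qed.

(** A projection remembers its word up to the deck transformation. *)
Lemma cover_ceq w w' s s' : cover_band w -> cover_band w' ->
  band s -> band s' -> map fst w = unroll s -> map fst w' = unroll s' ->
  ceq inv s s' <-> ceq cover_inv w w' \/ ceq cover_inv (map deck w) w'.
Proof.
move=> [cw pw] [cw' pw'] bs bs' es es'; split.
  have closed v : cyc w v \/ cyc (revmap cover_inv w) v -> cycle cover_next v.
    by case=> /(cyc_cycle cover_next)->; rewrite ?(cycle_revmap _ cover_next_inv).
  case=> [/unroll_cyc|/unroll_cyc].
    rewrite -es -es' => -[n]; rewrite -map_rot => /esym.
    case/(cover_fst_eq (closed _ (or_introl (cyc_rot n w))) cw') => ->.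
      by left; left; apply: cyc_rot.
    by right; left; rewrite map_rot; apply: cyc_rot.
  rewrite unroll_revmap; last by case: bs.
  rewrite -es -es' -fst_revmap => -[n]; rewrite -map_rot => /esym.
  case/(cover_fst_eq (closed _ (or_intror (cyc_rot n _))) cw') => ->.
    by left; right; apply: cyc_rot.
  by right; right; rewrite map_rot revmap_deck; apply: cyc_rot.
have [[cs ps] [_ ps']] := (bs, bs').
suff fold v : map fst v = map fst w -> ceq cover_inv v w' -> ceq inv s s'.
  by case; apply: fold; rewrite ?fst_deck.
rewrite es => ev [|] /(cyc_map fst); rewrite ?fst_revmap ev es'.
  by left; apply: cyc_unroll.
rewrite -unroll_revmap // => /cyc_unroll red; right.
by apply: red => //; apply: primitive_revmap.
Qed.

Definition infix_of w u := exists p q, w = p ++ u ++ q.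

Lemma cover_band_cyc w w' : cyc w w' -> cover_band w -> cover_band w'.
Proof.
by move=> ww' [cw pw]; split;
  [rewrite (cyc_cycle _ ww') | apply: primitive_cyc pw].
Qed.

(** The deck transformation matches the two halves at both turning points,
    since a word can only turn back where the sheet changes. *)
Lemma cycle_mirror p i : p <> [::] -> cycle next (p ++ revmap inv p) ->
  cycle cover_next (lift_word i p ++ revmap cover_inv (map deck (lift_word i p))).
Proof.
case: p => // x p _; rewrite cycle_mirrorE // => /and3P[px turn_p turn_x].
have -> w : revmap cover_inv (map deck w) = revmap (cover_inv \o deck) w.
  by rewrite /revmap map_comp.
rewrite cycle_mirrorE => [|y z]; last by rewrite cover_next_inv cover_next_deck.
rewrite path_lift fst_lift px eqxx /=; set l := last _ _.
have el : l.1 = last x p by rewrite /l -(last_map fst) fst_lift.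
rewrite /cover_next /= el turn_p (next_flip turn_p) addbT eqxx turn_x /=.
have /next_flip : next (inv x) (inv (inv x)) by rewrite invK.
by rewrite invK => ->; rewrite !addbT negbK.
Qed.

Lemma ceq_parity s t : band s -> ceq inv s t -> parity t = parity s.
Proof. by case=> cs _ [] /parity_cyc // ->; apply: parity_revmap. Qed.

(** For the core of a band this means that the band is symmetric. *)
Definition reversible s := cyc s (revmap inv s).

Lemma ceq_reversible s t : ceq inv s t -> reversible s -> reversible t.
Proof.
move=> st ss; have ts : cyc t s.
  by case: st => /cyc_sym // /cyc_trans; apply; apply: cyc_sym.
exact: cyc_trans (cyc_trans ts ss) (cyc_revmap _ (cyc_sym ts)).
Qed.

Lemma reversible_mirror s : band s -> reversible s ->
  exists p, [/\ p <> [::], cyc s (p ++ revmap inv p) & cycle next (p ++ revmap inv p)].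
Proof.
case=> cs [s0 _] /(cyc_revmap_split invK inv_neq)[p sp]; exists p; split=> //.
  by move=> p0; apply/s0/size0nil; rewrite -(cyc_size sp) p0.
by rewrite (cyc_cycle _ sp).
Qed.

(** The mirror image of a word closes up in the cover, which only words of even
    parity do. *)
Lemma reversible_even s : band s -> reversible s -> ~~ parity s.
Proof.
move=> bs /(reversible_mirror bs)[p [p0 sp /(cycle_mirror false p0)]].
by case/cycle_cover=> _; rewrite -(parity_cyc sp) map_cat fst_revmap fst_deck fst_lift.
Qed.

(** The projection of the right-hand side is a square, which a primitive word of
    even parity is not. *)
Lemma odd_bandP w s : cover_band w -> band s -> map fst w = unroll s ->
  parity s <->
  exists2 u, infix_of w u &
    cover_band (map deck u ++ u) /\ ceq cover_inv w (map deck u ++ u).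
Proof.
move=> bw bs es; split=> [odd_s|[u _ [bu wu]]].
  have [cw _] := bw; have [_ _ [i ew]] := (cycle_cover w).1 cw.
  move: ew; rewrite es /unroll odd_s power2 lift_square // => ew.
  exists (lift_word (~~ i) s); first by exists (lift_word i s), [::]; rewrite cats0.
  by rewrite deck_lift negbK -ew; split=> //; apply: ceq_refl.
have [s' bs' es'] := band_of_cover bu.
have /(ceq_parity bs) <- : ceq inv s s'.
  by apply/(cover_ceq bw bu bs bs' es es'); left.
move: es'; rewrite map_cat fst_deck -power2 => es'; apply/negPn/negP=> even_s'.
have [_ [_ ps']] := bs'; have := ps' 2 (map fst u).
by rewrite es' /unroll (negPf even_s') power1 => /(_ erefl).
Qed.

(** The lift of p followed by the inverse of p is a rotation of w; whatever the
    position where w starts, one of the two halves does not wrap around. *)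
Lemma reversible_bandP w s : cover_band w -> band s -> map fst w = unroll s ->
  reversible s <->
  exists2 u, infix_of w u &
    cover_band (revmap cover_inv (map deck u) ++ u) /\
    ceq cover_inv w (revmap cover_inv (map deck u) ++ u).
Proof.
move=> bw bs es; split=> [ss|[u _ [bu wu]]].
  have [p [p0 sp cp]] := reversible_mirror bs ss.
  have even_s := reversible_even bs ss; have [cw _] := bw.
  pose mirror v := revmap cover_inv (map deck v).
  have mirrorK : involutive mirror.
    by move=> v; rewrite /mirror revmap_deck (revmapK cover_invK) map_deckK.
  have cut v m : m <= size v -> w = rot m (v ++ mirror v) ->
      exists2 u, infix_of w u &
        cover_band (mirror u ++ u) /\ ceq cover_inv w (mirror u ++ u).
    move=> le_m ew; exists (mirror v).
      exists (drop m v), (take m v); rewrite ew /rot take_cat drop_cat.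
      case: ltnP => [_|]; first by rewrite -catA.
      move=> le_v; have -> : m = size v by apply/eqP; rewrite eqn_leq le_m.
      by rewrite subnn drop0 take0 cats0 drop_size take_size.
    rewrite mirrorK; have wv : cyc w (v ++ mirror v).
      by rewrite ew; apply/cyc_sym/cyc_rot.
    by split; [apply: cover_band_cyc bw | left].
  have [v [n ew]] : exists v n, w = rot n (v ++ mirror v).
    have [n es1] := cyc_sym sp; pose v := lift_word false p.
    have cv : cycle cover_next (rot n (v ++ mirror v)).
      by rewrite rot_cycle; apply: cycle_mirror.
    have /esym : map fst w = map fst (rot n (v ++ mirror v)).
      rewrite es /unroll (negPf even_s) power1 map_rot map_cat fst_revmap.
      by rewrite fst_deck fst_lift.
    case/(cover_fst_eq cv cw) => ->; first by exists v, n.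
    by exists (map deck v), n; rewrite map_rot map_cat -revmap_deck.
  have [m] := rot_small n (v ++ mirror v); rewrite -ew => le_m {}ew.
  have [/cut|/ltnW le_v] := leqP m (size v); first exact.
  (* Beyond the first half, rotate the pair of halves with its halves swapped. *)
  apply: (cut (mirror v) (m - size v)).
    rewrite leq_subLR (leq_trans le_m) // size_cat !size_revmap !size_map //.
  rewrite mirrorK ew -[in LHS](subnK le_v) rotD ?rot_size_cat //.
  by rewrite subnK.
have [s' bs' es'] := band_of_cover bu.
apply: (@ceq_reversible s').
  by apply/ceq_sym => //; apply/(cover_ceq bw bu bs bs' es es'); left.
have [[cs' ps'] ib] := (bs', band_revmap bs').
rewrite /reversible; suff -> : revmap inv s' = s' by apply: cyc_refl.
apply: unroll_eq => //; first by case: ib.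
rewrite unroll_revmap // -es' map_cat fst_revmap fst_deck revmap_cat //.
by rewrite revmapK.
Qed.

(** If the deck transformation rotates w, its projection has a nontrivial
    period and thus covers an odd band twice; if it reverses w, the projection
    is reversible. *)
Lemma invariant_bandP w s : cover_band w -> band s -> map fst w = unroll s ->
  ceq cover_inv (map deck w) w <-> parity s \/ reversible s.
Proof.
move=> bw bs es; split=> [|].
  have [[cs ps] [_ [w0 _]]] := (bs, bw); case=> [/cyc_sym[n]|]; last first.
    move/(cyc_map fst); rewrite fst_revmap fst_deck es -unroll_revmap //.
    move/(cyc_unroll (primitive_revmap invK ps) ps)/cyc_sym => ss; by right.
  have [m le_m ->] := rot_small n w => ew; left; apply: contraT => even_s.
  have := congr1 (map fst) ew; rewrite fst_deck map_rot.
  rewrite es /unroll (negPf even_s) power1 => /esym fix_s.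
  case: (deck_neq w0); rewrite ew; have [lt_m|] := ltnP m (size s).
    by rewrite (primitive_rot ps lt_m fix_s) rot0.
  move=> le_s; rewrite rot_oversize // -(size_map fst) es /unroll.
  by rewrite (negPf even_s) power1.
have deck_ceq v : ceq cover_inv w v -> ceq cover_inv (map deck v) v ->
    ceq cover_inv (map deck w) w.
  move=> wv dv; apply: (ceq_trans cover_invK _ (ceq_sym cover_invK wv)).
  apply: (ceq_trans cover_invK _ dv).
  case: wv => [/(cyc_map deck)|/(cyc_map deck)]; first by left.
  by rewrite -revmap_deck; right.
case=> [/(odd_bandP bw bs es)|/(reversible_bandP bw bs es)] [u _ [_ /deck_ceq]]; apply.
  left; apply/cycP; exists u, (map deck u).
  by rewrite map_cat map_deckK.
right; rewrite revmap_deck revmap_cat (revmapK cover_invK) map_cat map_deckK.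
by rewrite revmap_deck; apply: cyc_refl.
Qed.

End Cover.

Arguments deck {X} x.

(** * Words over a triple with quadratic monomial relations *)

Definition quadratic (K : fieldType) (B : triple K) :=
  forall p, Z1 B p -> size p = 2 /\ all (fun a => ~~ is_eta a) p.

Section Words.
Variables (K : fieldType) (B : triple K).
Hypothesis quadB : quadratic B.
Implicit Types (x y : symbol B) (s : seq (symbol B)) (u w : word B).

Definition banned x y :=
  [&& ~~ x.2, ~~ y.2 & Z1 B [:: x.1; y.1]] || [&& x.2, y.2 & Z1 B [:: y.1; x.1]].

(** The local form of (S1) and (S2). *)
Definition allowed x y :=
  [&& x != sinv y, ~~ banned x y & ~~ (crease_symbol x && (x == y))].

Definition adjacent x y := stgt x == ssrc y.

Definition follows x y := adjacent x y && allowed x y.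

(** The source of a nonempty word is recorded in addition to its symbols; this is
    the compatibility of both. *)
Definition starts_at w := if w.2 is x :: _ then ssrc x == w.1 else true.

Definition unsigned w := [seq forget_sign x | x <- w.2].

Lemma sinvK : involutive (@sinv K B).
Proof. by case=> a e; rewrite /sinv /= negbK. Qed.

Lemma sinv_neq x : sinv x != x.
Proof. by case: x => a []; rewrite /sinv -pair_eqE /= andbF. Qed.

Lemma ssrc_sinv x : ssrc (sinv x) = stgt x.
Proof. by rewrite /ssrc /stgt /=; case: x.2. Qed.

Lemma stgt_sinv x : stgt (sinv x) = ssrc x.
Proof. by rewrite /ssrc /stgt /=; case: x.2. Qed.

Lemma follows_sinv x y : follows (sinv y) (sinv x) = follows x y.
Proof.
rewrite /follows /adjacent stgt_sinv ssrc_sinv [ssrc y == _]eq_sym.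
congr (_ && _); congr [&& ~~ _, ~~ _ & ~~ _].
- by rewrite sinvK eq_sym.
- by case: x y => [a []] [b []]; rewrite /banned //= orbF.
rewrite (inj_eq (inv_inj sinvK)) eq_sym.
by case: eqVneq => [->|]; rewrite ?andbF.
Qed.

Lemma crease_symbol_vertex x : crease_symbol x -> crease B (ssrc x).
Proof. by case: x => [[//|v] []] _; apply: (valP v). Qed.

Lemma follows_crease x y : follows x y -> ~~ (crease_symbol x && crease_symbol y).
Proof.
case: x y => [[a|v] e] [[b|v'] f] //=; rewrite /follows /adjacent.
have -> : (stgt (inr v : arrow B, e) == ssrc (inr v' : arrow B, f)) = (v == v').
  by case: e f => [] [].
case/andP=> /eqP <-; rewrite /allowed /= -!pair_eqE /= eqxx /=.
by case: e f => [] [] /and3P[].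
Qed.

Lemma forget_sinv x : forget_sign (sinv (forget_sign x)) = forget_sign (sinv x).
Proof. by case: x => [[a|v] e]. Qed.

Lemma ssrc_forget x : ssrc (forget_sign x) = ssrc x.
Proof. by case: x => [[a|v] []]. Qed.

Lemma stgt_forget x : stgt (forget_sign x) = stgt x.
Proof. by case: x => [[a|v] []]. Qed.

Lemma crease_forget x : crease_symbol (forget_sign x) = crease_symbol x.
Proof. by case: x => [[a|v] []]. Qed.

Lemma banned_crease x y : crease_symbol x || crease_symbol y -> banned x y = false.
Proof.
move=> xy; apply/negP => /orP[] /and3P[_ _ /quadB[_]] /=;
by move: xy; rewrite /crease_symbol andbT; case: is_eta; case: is_eta.
Qed.

(** The sign of a crease symbol matters only next to another crease symbol, and
    no two crease symbols of a string or band are adjacent. *)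
Lemma forget_follows x y : follows (forget_sign x) (forget_sign y) = follows x y.
Proof.
have no z t : crease_symbol z -> crease_symbol t -> follows z t = false.
  by move=> cz ct; apply/negP => /follows_crease; rewrite cz ct.
have [cx|/negbTE cx] := boolP (crease_symbol x);
    have [cy|/negbTE cy] := boolP (crease_symbol y).
- by rewrite !no ?crease_forget.
- rewrite /follows /adjacent ssrc_forget stgt_forget /allowed.
  rewrite !banned_crease ?crease_forget ?cx //.
  by case: x y cx cy => [[a|v] e] [[b|v'] f].
- rewrite /follows /adjacent ssrc_forget stgt_forget /allowed.
  rewrite !banned_crease ?crease_forget ?cy ?orbT //.
  by case: x y cx cy => [[a|v] e] [[b|v'] f].
- by rewrite /forget_sign cx cy.
Qed.

Lemma unsigned_cycle w : cycle follows (unsigned w) = cycle follows w.2.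
Proof. by rewrite cycle_map; apply: eq_cycle => x y /=; apply: forget_follows. Qed.

Lemma is_walk_cat v s t :
  is_walk v (s ++ t) = is_walk v s && is_walk (last v (map (@stgt K B) s)) t.
Proof. by elim: s v => //= x s IHs v; rewrite IHs andbA. Qed.

Lemma is_walkE v s : is_walk v s = starts_at (v, s) && sorted adjacent s.
Proof.
case: s => //= x s; congr (_ && _); elim: s x => //= y s IHs x.
by rewrite IHs [in LHS]eq_sym.
Qed.

Lemma sorted_infix (e : rel (symbol B)) s :
  sorted e s <-> forall p x y q, s = p ++ [:: x; y] ++ q -> e x y.
Proof.
split=> [+ p x y q es|].
  by rewrite es => /cat_sorted2[_] /= /andP[].
case: s => // x s; elim: s x => //= y s IHs x es; rewrite (es [::] x y s) //=.
by apply: IHs => p z t q ep; apply: (es (x :: p) z t q); rewrite ep.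
Qed.

(** The relations have length 2 and powers of crease symbols contain squares,
    so S1 and S2 only constrain consecutive symbols. *)
Lemma S12_local w : S1 w /\ S2 w <-> sorted allowed w.2.
Proof.
split=> [[w1 [w2 w3]]|w12].
  apply/sorted_infix => p x y q ew; apply/and3P.
  have sub : subword (wtgt (w.1, p), [:: x; y]) w by exists p, q.
  split; first exact: ((sorted_infix _ _).1 w1 p x y q ew).
    have [no noV] := w2 _ sub.
    apply/negP => /orP[] /and3P[ex ey Zxy].
      apply: no; exists [:: x.1; y.1] => //=.
      by rewrite /= -{1}(negbTE ex) -(negbTE ey) -!surjective_pairing.
    apply: noV; exists [:: y.1; x.1] => //=.
    by rewrite /winv /sinv /= ex ey.
  apply/andP=> -[cx /eqP exy]; apply: (w3 _ x 2 cx (leqnn _) sub).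
  by rewrite /= exy.
split.
  by apply: sub_sorted w12 => x y /and3P[].
have no u x y : subword u w -> u.2 = [:: x; y] -> allowed x y.
  case=> p [q [ew _]] eu; apply: ((sorted_infix _ _).1 w12 p x y q).
  by rewrite ew eu.
split=> [u sub|u x [|[|k]] // cx _ [p [q [ew _]]] eu].
  split; case=> p Zp eu.
    have [] := quadB Zp; case: p Zp eu => [|a [|b []]] //= Zp eu _ _.
    by have /and3P[_ /negP[]] := no u _ _ sub eu; apply/orP; left.
  have [] := quadB Zp; case: p Zp eu => [|a [|b []]] //= Zp eu _ _.
  have eu2 : u.2 = [:: (b, true); (a, true)].
    by rewrite -[u.2](revmapK sinvK) /revmap eu.
  by have /and3P[_ /negP[]] := no u _ _ sub eu2; apply/orP; right.
have : allowed x x.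
  apply: ((sorted_infix _ _).1 w12 p x x (nseq k x ++ q)).
  by rewrite ew eu.
by rewrite /allowed cx eqxx !andbF.
Qed.

Lemma string_iff w :
  is_string w <-> [/\ starts_at w, sorted follows w.2 & S3 w].
Proof.
have sf : sorted follows w.2 = sorted adjacent w.2 && sorted allowed w.2.
  exact: sorted_relI.
split=> [[ww w1 w2 w3]|[sw]].
  have /S12_local sa : S1 w /\ S2 w by [].
  by move: ww; rewrite /is_word is_walkE -surjective_pairing sf sa => /andP[-> ->].
rewrite sf => /andP[sadj /S12_local[w1 w2]] w3; split=> //.
by rewrite /is_word is_walkE -surjective_pairing sw.
Qed.

Lemma wtgt_winv w : is_word w -> wtgt (winv w) = wsrc w.
Proof.
case: w => v [//|y s]; rewrite /is_word /= => /andP[/eqP <- _].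
by rewrite /wtgt /winv /= rev_cons map_rcons last_rcons stgt_sinv.
Qed.

Lemma winvK w : is_word w -> winv (winv w) = w.
Proof.
move=> ww; rewrite {1}/winv (wtgt_winv ww) [w in RHS]surjective_pairing.
by congr (_, _); apply: (revmapK sinvK w.2).
Qed.

Lemma sim2_winv u w : sim2 u w -> sim2 (winv u) (winv w).
Proof.
case=> e1 e2; split.
  have tgtE s : map (@stgt K B) s = map (@stgt K B) (map (@forget_sign K B) s).
    by rewrite -map_comp; apply: eq_map => x /=; rewrite stgt_forget.
  by rewrite /winv /wtgt /= e1 tgtE e2 -tgtE.
have invE (v : word B) : map (@forget_sign K B) (winv v).2 =
    rev (map (fun x => forget_sign (sinv x)) (map (@forget_sign K B) v.2)).
  rewrite /winv /= map_rev -!map_comp; congr rev.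
  by apply: eq_map => x /=; rewrite forget_sinv.
by rewrite !invE e2.
Qed.

Lemma sim2_refl w : sim2 w w. Proof. by []. Qed.

Lemma sim2_sym u w : sim2 u w -> sim2 w u.
Proof. by case=> e1 e2; split. Qed.

Lemma sim2_trans u v w : sim2 u v -> sim2 v w -> sim2 u w.
Proof. by case=> e1 e2 [e3 e4]; split; [rewrite e1 | rewrite e2]. Qed.

Lemma word_equiv_refl w : word_equiv w w.
Proof. by exists w; split; [left | apply: sim2_refl]. Qed.

Lemma word_equiv_sym u w : is_word u -> word_equiv u w -> word_equiv w u.
Proof.
move=> wu [v [[->|->]]] /sim2_sym uw; first by exists w; split; first by left.
exists (winv w); split; first by right.
by rewrite -(winvK wu); apply: sim2_winv.
Qed.

Lemma word_equiv_trans u v w : is_word u ->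
  word_equiv u v -> word_equiv v w -> word_equiv u w.
Proof.
move=> wu [u' [uu' u'v]] [v' [[->|->] v'w]].
  by exists u'; split=> //; apply: sim2_trans v'w.
exists (winv u'); split; last exact: sim2_trans (sim2_winv u'v) v'w.
by case: uu' => ->; [right | left; apply: winvK].
Qed.

Lemma symmetric_string_equiv u w :
  word_equiv u w -> symmetric_string u -> symmetric_string w.
Proof.
move=> [v [uv vw]] [su uu]; have vv : sim2 v (winv v).
  by case: uv => -> //; apply: sim2_winv.
split; last first.
  exact: sim2_trans (sim2_sym vw) (sim2_trans vv (sim2_winv vw)).
rewrite /simple => w0; apply/su/size0nil.
have := congr1 size vw.2; rewrite w0 size_map => /size0nil.
by case: uv => -> //= /(congr1 size); rewrite size_rev size_map.
Qed.

Lemma reduced_winv_neq w : reduced w -> w.2 <> [::] -> winv w <> w.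
Proof.
move=> rw w0 /(congr1 snd)/(palindrome_split sinv_neq)[q].
case/lastP: q => // q x eq; move: rw; rewrite /reduced eq /revmap map_rcons rev_rcons.
by rewrite cat_rcons sorted_cat_cons /= sinvK eqxx andbF.
Qed.

(** * Reduction of words *)

Definition push x s := if s is y :: s' then if x == sinv y then s' else x :: s
                       else [:: x].

Definition red s := foldr push [::] s.

Local Notation reduced_seq := (sorted (fun x y => x != sinv y)).

Lemma red_id s : reduced_seq s -> red s = s.
Proof.
elim: s => //= x s IHs px; rewrite IHs; last exact: path_sorted px.
by case: s px {IHs} => //= y s /andP[/negPf->].
Qed.

Lemma reduced_red s : reduced_seq (red s).
Proof.
elim: s => //= x s; case: (red s) => //= y t pt.
by case: ifP => [_|/= ->//]; apply: path_sorted pt.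
Qed.

Lemma pushK x s : reduced_seq s -> push x (push (sinv x) s) = s.
Proof.
case: s => [|y s] /=; first by rewrite sinvK eqxx.
rewrite (inj_eq (inv_inj sinvK)); case: eqVneq => [->|_] /=; last by rewrite sinvK eqxx.
by case: s => //= z s /andP[/negPf->].
Qed.

Lemma red_cat s t : red (s ++ t) = foldr push (red t) s.
Proof. exact: foldr_cat. Qed.

Lemma red_cancel s p t : red (s ++ p ++ revmap (@sinv K B) p ++ t) = red (s ++ t).
Proof.
rewrite !red_cat; congr foldr; rewrite -red_cat.
elim: p t => //= x p IHp t; rewrite /revmap /= rev_cons cat_rcons IHp.
by apply: pushK; apply: reduced_red.
Qed.

(** Juxtaposing two reduced words cancels a maximal common part. *)
Lemma red_cat_split s t : reduced_seq s -> reduced_seq t ->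
  exists p s1 t1, [/\ s = s1 ++ revmap (@sinv K B) p, t = p ++ t1 &
                      red (s ++ t) = s1 ++ t1].
Proof.
elim/last_ind: s t => [|s x IHs] t rs rt.
  by exists [::], [::], t; rewrite red_id.
have rs' : reduced_seq s by move: rs; rewrite -cats1 => /cat_sorted2[].
case: t rt => [|y t] rt.
  by exists [::], (rcons s x), [::]; rewrite !cats0 red_id.
have [exy|nxy] := eqVneq x (sinv y).
  have [p [s1 [t1 [es et er]]]] := IHs t rs' (path_sorted rt).
  exists (y :: p), s1, t1; rewrite /revmap /= rev_cons -rcons_cat -es -et exy.
  split=> //; rewrite -er cat_rcons.
  rewrite -[sinv y :: y :: t]/([:: sinv y] ++ [:: y] ++ t).
  rewrite -{2}(sinvK y); exact: (red_cancel s [:: sinv y] t).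
exists [::], (rcons s x), (y :: t); rewrite cats0; split=> //.
apply: red_id; rewrite cat_rcons sorted_cat_cons rs /= nxy.
exact: rt.
Qed.

(** A reduced word is a conjugate of a cyclically reduced one. *)
Lemma conjugate_split s : reduced_seq s -> s <> [::] ->
  exists p c, [/\ s = p ++ c ++ revmap (@sinv K B) p, c <> [::] &
                  cycle (fun x y => x != sinv y) c].
Proof.
have [n] := ubnP (size s); elim: n s => // n IHn [//|x s] lt_n rs _.
have [cs|ncs] := boolP (cycle (fun x y => x != sinv y) (x :: s)).
  by exists [::], (x :: s); rewrite cats0.
move: rs ncs lt_n; case/lastP: s => [|s y] /=.
  by rewrite andbT eq_sym sinv_neq.
rewrite ltnS size_rcons => rs; rewrite rcons_path rs last_rcons negbK /= => /eqP ey.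
rewrite {}ey in rs * => /ltnW lt_n.
have rs' : reduced_seq s by move: rs; rewrite rcons_path => /andP[/path_sorted].
case: s rs rs' lt_n => [|z s] rs rs' lt_n; first by rewrite /= sinvK eqxx in rs.
have [//|//|//|p [c [es c0 cc]]] := IHn (z :: s).
exists (x :: p), c; split=> //.
by rewrite es /revmap /= rev_cons !rcons_cat.
Qed.

Lemma sorted_glue (e : rel (symbol B)) s c t : c <> [::] ->
  sorted e (s ++ c) -> sorted e (c ++ t) -> sorted e (s ++ c ++ t).
Proof.
case: c => // x c _; rewrite /= !sorted_cat_cons => /andP[-> _].
by rewrite cat_path.
Qed.

(** Between consecutive factors of the power, p cancels against its inverse. *)
Lemma red_power_conj p c q k : c <> [::] -> cycle (fun x y => x != sinv y) c ->
  q = revmap (@sinv K B) p -> reduced_seq (p ++ c ++ q) -> 0 < k ->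
  red (power k (p ++ c ++ q)) = p ++ power k c ++ q.
Proof.
move=> c0 cc eq rs; have rcq : reduced_seq (c ++ q) by case/cat_sorted2: rs.
have rck k' : 0 < k' -> reduced_seq (power k' c ++ q).
  elim: k' => // [[|k']] IHk _; first by rewrite power1.
  rewrite !powerS -!catA; apply: sorted_glue => //.
    by rewrite -power2; apply: sorted_power.
  by rewrite catA -powerS; apply: IHk.
have rpk k' : 0 < k' -> reduced_seq (p ++ power k' c ++ q).
  case: k' => // k' _; rewrite powerS -catA; apply: sorted_glue => //.
    by move: rs; rewrite catA => /cat_sorted2[].
  by rewrite catA -powerS; apply: rck.
elim: k => // [[|k]] IHk _; first by rewrite !power1 red_id.
rewrite powerS red_cat IHk // -[X in foldr _ X]red_id ?rpk // -red_cat.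
rewrite -catA -[(c ++ q) ++ _]catA.
have ep : p = revmap (@sinv K B) q by rewrite eq (revmapK sinvK).
rewrite [X in q ++ X ++ _]ep [p ++ c ++ _]catA red_cancel -catA.
by rewrite [c ++ _ ++ q]catA -powerS [LHS]red_id //; apply: rpk.
Qed.

(** * Bands as primitive cyclic words *)

Lemma word_eq w w' : w.2 <> [::] -> starts_at w -> starts_at w' ->
  w.2 = w'.2 -> w = w'.
Proof.
case: w w' => [v [|x s]] [v' s'] // _; rewrite /starts_at /= => /eqP ev + es.
by rewrite -{}es => /eqP <-; rewrite ev.
Qed.

Lemma closed_walkE w : w.2 <> [::] ->
  (is_word w /\ wsrc w = wtgt w) <-> (starts_at w /\ cycle adjacent w.2).
Proof.
case: w => v [|x s] // _; rewrite /is_word is_walkE /starts_at /wtgt /wsrc /=.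
rewrite rcons_path last_map; split=> [[/andP[/eqP <- ->] ex]|[/eqP <- /andP[-> /eqP ->]]].
  by rewrite /adjacent ex !eqxx.
by rewrite eqxx.
Qed.

Lemma wpow_local w : (forall k, S1 (wpow w k) /\ S2 (wpow w k)) <-> cycle allowed w.2.
Proof.
split=> [/(_ 2)/S12_local|cw k]; last by apply/S12_local/sorted_power.
by rewrite /= cats0; apply: sorted_square.
Qed.

Lemma unsigned_winv w :
  unsigned (winv w) = revmap (fun x => forget_sign (sinv x)) (unsigned w).
Proof.
rewrite /unsigned /winv /revmap /= map_rev -!map_comp; congr rev.
by apply: eq_map => x /=; rewrite forget_sinv.
Qed.

Lemma winv2K s : revmap (@sinv K B) (revmap (@sinv K B) s) = s.
Proof. exact: revmapK sinvK s. Qed.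

Lemma winv_starts w : is_word w -> starts_at (winv w).
Proof.
case: w => v s; rewrite /is_word /starts_at /winv /wtgt /=.
case/lastP: s => //= s x _; rewrite map_rcons rev_rcons map_rcons last_rcons.
by rewrite ssrc_sinv.
Qed.

Lemma winv_word w : is_word w -> is_word (winv w).
Proof.
move=> ww; have := winv_starts ww; rewrite /is_word !is_walkE => -> /=.
rewrite (@sorted_revmap _ adjacent _ w.2) => [|x y].
  by move: ww; rewrite /is_word is_walkE => /andP[].
by rewrite /adjacent stgt_sinv ssrc_sinv eq_sym.
Qed.

Lemma cycle_follows w : cycle follows w.2 = cycle adjacent w.2 && cycle allowed w.2.
Proof. exact: cycle_relI. Qed.

Lemma primitive_unsigned_winv w :
  primitive (unsigned w) -> primitive (unsigned (winv w)).
Proof.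
move=> [w0 pw]; split=> [e|k u e].
  apply: w0; apply: size0nil; have := congr1 size e.
  by rewrite !size_map size_rev size_map.
apply: (pw k (revmap (fun x => forget_sign (sinv x)) u)).
rewrite -revmap_power -e -unsigned_winv /unsigned /=; congr map.
exact/esym/winv2K.
Qed.

(** Condition (B3) amounts to primitivity after forgetting signs.  Reducing the power of a subword u = pcq
    with q inverse to p conjugates the power of c by p, which can only be a
    cyclically reduced word if p is empty. *)
Lemma band_iff w :
  is_band w <-> [/\ starts_at w, cycle follows (unsigned w) & primitive (unsigned w)].
Proof.
have unsigned0 : unsigned w = [::] <-> w.2 = [::].
  by split=> [/(congr1 size)|e]; rewrite /unsigned ?e //; case: w.2.
split=> [[ww [w0 _] [wc wp] prim]|[sw cw pw]].
  have [sw cadj] := (closed_walkE w0).1 (conj ww wc).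
  have cw : cycle follows (unsigned w).
    by rewrite unsigned_cycle cycle_follows cadj; apply/wpow_local.
  split=> //; split=> [/unsigned0 //|k v ev].
  case: k ev => [/unsigned0 //|[//|k]] ev.
  have v0 : v <> [::] by move=> v0; apply/w0/unsigned0; rewrite ev v0 power_nil.
  pose u : word B := (w.1, take (size v) w.2).
  have ew : w.2 = u.2 ++ drop (size v) w.2 by rewrite cat_take_drop.
  have nu : unsigned u = v.
    by rewrite /unsigned map_take -/(unsigned w) ev powerS take_size_cat.
  have u0 : u.2 <> [::] by move=> u0; apply: v0; rewrite -nu /unsigned u0.
  have cu : cycle follows u.2.
    by rewrite -unsigned_cycle nu -(@cycle_power _ _ k.+2) // -ev.
  have su : starts_at u by move: sw u0; rewrite /starts_at ew /=; case: take.
  have [_ uc] : is_word u /\ wsrc u = wtgt u.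
    by apply/closed_walkE => //; split=> //; move: cu; rewrite cycle_follows => /andP[].
  case: (prim u k.+2) => //.
  - by exists [::], (drop (size v) w.2).
  - move=> uw; have := congr1 size ev.
    rewrite size_power -[in unsigned w]uw nu; case: (v) v0 => // x v' _ /=.
    by move/eqP; rewrite -[X in X == _]mul1n eqn_mul2r.
  exists w; split; first by left.
  split=> //; change (unsigned w = map (@forget_sign K B) (red (power k.+2 u.2))).
  rewrite red_id; first by rewrite map_power -/(unsigned u) nu.
  apply: sorted_power; apply: sub_cycle cu => x y /andP[_ /and3P[]] //.
have w0 : w.2 <> [::] by move/unsigned0; case: pw.
have := cw; rewrite unsigned_cycle cycle_follows => /andP[cadj call].
have [ww wc] := (closed_walkE w0).2 (conj sw cadj).
have wp := (wpow_local w).2 call.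
split=> //.
  split=> // x cx ew; move: call; rewrite ew /= andbT.
  by rewrite /allowed cx eqxx !andbF.
move=> u k [p [q [ew eu]]] uw uc k0 [w1 [ww1 [_]]].
have [c1 p1] : cycle follows (unsigned w1) /\ primitive (unsigned w1).
  case: ww1 => -> //; split; last exact: primitive_unsigned_winv.
  by rewrite unsigned_cycle (@cycle_revmap _ follows _ w.2) -?unsigned_cycle // => x y;
    apply: follows_sinv.
have sz1 : size w1.2 = size w.2.
  by case: ww1 => ->; rewrite //= size_rev size_map.
change (unsigned w1 = map (@forget_sign K B) (red (power k u.2)) -> False) => e1.
have u0 : u.2 <> [::].
  by move=> u0; case: p1 => + _; apply; rewrite e1 u0 power_nil.
have ru : reduced_seq u.2.
  have [+ _] := wp 1; rewrite /S1 /reduced /= cats0 ew.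
  by case/cat_sorted2=> _ /cat_sorted2[].
have [[|x a] [c [ea c0 cc]]] := conjugate_split ru u0.
  move: ea; rewrite cats0 /= => ea; rewrite -ea in cc.
  move: e1; rewrite red_id; last exact: sorted_power.
  rewrite map_power => e1; have [_ /(_ _ _ e1) k1] := p1.
  have := congr1 size e1; rewrite k1 power1 !size_map sz1 ew !size_cat.
  move=> /eqP; rewrite addnCA -[X in _ == X]addn0 eqn_add2l addn_eq0.
  case/andP=> /nilP p0 /nilP q0; apply: uw.
  move: ew eu; rewrite p0 q0 cats0 /wtgt /=; case: (u) (w) => ? ? [? ?] /=.
  by move=> -> ->.
move: e1; rewrite ea (red_power_conj c0 cc _ _ k0) -?ea //.
move=> e1; move: c1; rewrite e1 /= /revmap /= rev_cons -!rcons_cat map_rcons.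
rewrite rcons_path last_rcons => /andP[_].
by rewrite forget_follows /follows /allowed eqxx andbF.
Qed.

Lemma band_winv w : is_band w -> is_band (winv w).
Proof.
move=> bw; have [ww _ _ _] := bw; move/band_iff: bw => [_ cw pw].
apply/band_iff; split; [exact: winv_starts| |exact: primitive_unsigned_winv].
rewrite unsigned_cycle (@cycle_revmap _ follows _ w.2) -?unsigned_cycle //.
exact: follows_sinv.
Qed.

Lemma unsigned_wrot n w : unsigned (wrot n w) = rot n (unsigned w).
Proof. exact: map_rot. Qed.

Lemma band_wrot n w : is_band w -> is_band (wrot n w).
Proof.
move=> bw; have [ww [w0 _] [wc _] _] := bw; move/band_iff: bw => [sw cw pw].
apply/band_iff; rewrite unsigned_wrot rot_cycle; split=> //; last first.
  exact: primitive_cyc (cyc_rot _ _) pw.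
rewrite /wrot /rot; have [lt_n|le_n] := ltnP n (size w.2); last first.
  by rewrite drop_oversize // take_oversize // -[X in wtgt X]surjective_pairing -wc.
have : is_walk w.1 (take n w.2 ++ drop n w.2) by rewrite cat_take_drop.
rewrite is_walk_cat => /andP[_]; rewrite is_walkE => /andP[+ _].
by rewrite /starts_at /wtgt /=; case: drop (size_drop n w.2) => //=;
  move/esym/eqP; rewrite subn_eq0 leqNgt lt_n.
Qed.

Lemma band_starts w : is_band w -> starts_at w. Proof. by case/band_iff. Qed.

Lemma band_neq0 w : is_band w -> w.2 <> [::]. Proof. by case=> _ []. Qed.

Lemma unsigned_start w w' : w.2 <> [::] -> starts_at w -> starts_at w' ->
  unsigned w = unsigned w' -> w.1 = w'.1.
Proof.
case: w w' => [v [//|x s]] [v' [//|y t]] _; rewrite /starts_at /unsigned /=.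
by move=> /eqP <- /eqP <- [exy _]; rewrite -(ssrc_forget x) exy ssrc_forget.
Qed.

Lemma cyc_sim23 w w' : is_band w -> is_band w' -> cyc (unsigned w) (unsigned w') ->
  exists w2, [/\ is_band w2, sim2 w w2 & sim3 w2 w'].
Proof.
move=> bw bw' /cyc_sym[n en]; have [m le_m em] := rot_small n (unsigned w').
have b2 := band_wrot m bw'; exists (wrot m w').
have e2 : unsigned w = unsigned (wrot m w') by rewrite unsigned_wrot en em.
split=> //.
  split=> //; apply: unsigned_start => //; [exact: band_neq0 | exact: band_starts..].
exists (size w'.2 - m); apply: word_eq.
- exact: band_neq0.
- exact: band_starts.
- by apply/band_starts/band_wrot.
by have := rotK m w'.2; rewrite /rotr size_rot => /esym.
Qed.

(** Rotations commute with forgetting signs, so that the three relations that make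
    up the equivalence of bands reduce to a rotation of unsigned words. *)
Lemma band_equiv_iff w w' : is_band w ->
  band_equiv w w' <->
  is_band w' /\
  (cyc (unsigned w) (unsigned w') \/ cyc (unsigned (winv w)) (unsigned w')).
Proof.
move=> bw; split=> [[w1 [w2 [b1 b2 w1w [_ e12] [n ->]]]]|[bw' cww']].
  split; first exact: band_wrot.
  rewrite unsigned_wrot [unsigned w2](esym e12).
  by case: w1w => <-; [left|right]; apply: cyc_rot.
have [w1 b1 [w1w cw1]] : exists2 w1, is_band w1 &
    sim1 w w1 /\ cyc (unsigned w1) (unsigned w').
  case: cww' => cww'; first by exists w => //; split=> //; left.
  by exists (winv w); [apply: band_winv | split=> //; right].
have [w2 [b2 e12 e2]] := cyc_sim23 b1 bw' cw1.
by exists w1, w2; split.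
Qed.

Lemma symmetric_band_iff w : is_band w ->
  symmetric_band w <-> cyc (unsigned w) (unsigned (winv w)).
Proof.
move=> bw; split=> [[w' [bw' [_ e] [n en]]]|]; last first.
  by move/(cyc_sim23 bw (band_winv bw)).
by rewrite en unsigned_wrot [unsigned w]e; apply: cyc_rot.
Qed.

End Words.

(** * Ordinary symbols of a folded gentle triple *)

Lemma folded_quadratic (K : fieldType) (A : triple K) :
  folded_gentle A -> quadratic A.
Proof. by move=> fgA p Zp; split; [apply: fg4 fgA _ Zp | case: (fg_Z1 fgA Zp)]. Qed.

Section Ordinary.
Variables (K : fieldType) (A : triple K).
Implicit Types (v : vertex A) (s t : seq (symbol A)) (x y z : oarrow A * bool).

Local Notation osym := (oarrow A * bool)%type.

Definition of_ordinary x : symbol A := (inl x.1, x.2).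
Definition to_ordinary (y : symbol A) : option osym :=
  if y.1 is inl a then Some (a, y.2) else None.

Definition oinv x : osym := (x.1, ~~ x.2).

Definition turning x := crease A (ssrc (of_ordinary x)).

(** Succession in a string or band, once its crease symbols are deleted. *)
Definition onext x y := adjacent (of_ordinary x) (of_ordinary y) &&
  (turning y || allowed (of_ordinary x) (of_ordinary y)).

Definition core s := pmap to_ordinary s.

Definition creases v : seq (symbol A) :=
  if insub v is Some c then [:: (inr c, false)] else [::].

(** A crease symbol is restored before each symbol that leaves a crease vertex; a
    final one, at the end of a string, has to be added separately. *)
Definition expand (s : seq osym) :=
  flatten [seq rcons (creases (ssrc (of_ordinary x))) (of_ordinary x) | x <- s].

Lemma of_oinv x : of_ordinary (oinv x) = sinv (of_ordinary x). Proof. by []. Qed.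

Lemma oinvK : involutive oinv. Proof. by case=> a e; rewrite /oinv /= negbK. Qed.

Lemma oinv_neq x : oinv x != x.
Proof. by case: x => a []; rewrite -pair_eqE /= andbF. Qed.

Lemma turning_inv x y : onext x y -> turning (oinv x) = turning y.
Proof. by case/andP=> /eqP e _; rewrite /turning of_oinv ssrc_sinv e. Qed.

Lemma onext_inv x y : onext (oinv y) (oinv x) = onext x y.
Proof.
have := follows_sinv (of_ordinary x) (of_ordinary y); rewrite /onext /follows !of_oinv.
have -> : adjacent (sinv (of_ordinary y)) (sinv (of_ordinary x)) =
          adjacent (of_ordinary x) (of_ordinary y).
  by rewrite /adjacent ssrc_sinv stgt_sinv eq_sym.
case: (boolP (adjacent _ _)) => //= /eqP e ->.
by rewrite /turning of_oinv ssrc_sinv e.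
Qed.

Lemma turning_back x : onext x (oinv x) -> turning (oinv x).
Proof. by case/andP=> _ /orP[//|]; rewrite of_oinv /allowed sinvK eqxx. Qed.

Lemma core_of (x : osym) s : core (of_ordinary x :: s) = x :: core s.
Proof. by case: x. Qed.

Lemma symbol_cases (y : symbol A) :
  (exists2 x, y = of_ordinary x & crease_symbol y = false) \/
  (exists c : cvertex A, [/\ y.1 = inr c, crease_symbol y & to_ordinary y = None]).
Proof.
case: y => [[a|c] e]; first by left; exists (a, e).
by right; exists c.
Qed.

Lemma creasesP v : (crease A v /\ exists2 c : cvertex A, val c = v &
    creases v = [:: (inr c, false)]) \/ (~~ crease A v /\ creases v = [::]).
Proof.
rewrite /creases; case: insubP => [c cv ev|ncv]; last by right.
by left; split=> //; exists c.
Qed.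

Lemma core_creases v : core (creases v) = [::].
Proof. by rewrite /creases; case: insub. Qed.

Lemma core_cat s t : core (s ++ t) = core s ++ core t.
Proof. exact: pmap_cat. Qed.

Lemma expand_cons x (s : seq osym) : expand (x :: s) =
  creases (ssrc (of_ordinary x)) ++ of_ordinary x :: expand s.
Proof. by rewrite /expand /= cat_rcons. Qed.

Lemma core_expand (s : seq osym) : core (expand s) = s.
Proof.
elim: s => // x s IHs; rewrite expand_cons core_cat.
by rewrite core_creases core_of IHs.
Qed.

Lemma core_power k s : core (power k s) = power k (core s).
Proof. by elim: k => // k IHk; rewrite powerS core_cat IHk. Qed.

Lemma core_revmap s : core (revmap (@sinv K A) s) = revmap oinv (core s).
Proof.
elim: s => // y s IHs; rewrite /revmap /= rev_cons -cats1 core_cat [core (rev _)]IHs.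
case: y => [[a|c] e]; last by rewrite /core /= cats0.
by rewrite [RHS]/= rev_cons -cats1.
Qed.

Lemma core_forget s : core (map (@forget_sign K A) s) = core s.
Proof.
by elim: s => // -[[a|c] e] s IHs; rewrite /core /= -!/(core _) IHs.
Qed.

Lemma cyc_core s t : cyc s t -> cyc (core s) (core t).
Proof.
by move/cycP=> [a [b [-> ->]]]; apply/cycP; exists (core a), (core b);
  rewrite !core_cat.
Qed.

Lemma expand_cat (s t : seq osym) : expand (s ++ t) = expand s ++ expand t.
Proof. by rewrite /expand map_cat flatten_cat. Qed.

Lemma expand_power k (s : seq osym) : expand (power k s) = power k (expand s).
Proof. by elim: k => // k IHk; rewrite powerS expand_cat IHk. Qed.

Lemma cyc_expand (s t : seq osym) : cyc s t -> cyc (expand s) (expand t).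
Proof.
by move/cycP=> [a [b [-> ->]]]; apply/cycP; exists (expand a), (expand b);
  rewrite !expand_cat.
Qed.

Lemma count_crease_expand (s : seq osym) :
  count (@crease_symbol K A) (expand s) = count turning s.
Proof.
elim: s => // x s IHs; rewrite expand_cons count_cat /= IHs.
rewrite /turning; case: (creasesP (ssrc (of_ordinary x))) => [[-> [c _ ->]]|] //.
by case=> /negbTE -> ->.
Qed.

Lemma expand_forget (s : seq osym) : map (@forget_sign K A) (expand s) = expand s.
Proof.
elim: s => // x s IHs; rewrite expand_cons map_cat /= IHs.
by case: (creasesP (ssrc (of_ordinary x))) => [[_ [c _ ->]]|[_ ->]].
Qed.

Lemma primitive_expand (s : seq osym) : primitive (expand s) <-> primitive s.
Proof.
split=> -[s0 ps]; split=> [e|k u e].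
- by apply: s0; rewrite e.
- by apply: (ps k (expand u)); rewrite e expand_power.
- by apply: s0; rewrite -(core_expand s) e.
by apply: (ps k (core u)); rewrite -(core_expand s) e core_power.
Qed.

(** * Crease vertices *)

Hypothesis fgA : folded_gentle A.
Let quadA := folded_quadratic fgA.

Lemma Z1_crease (c : cvertex A) (a : arrow A) :
  ~~ Z1 A [:: inr c; a] /\ ~~ Z1 A [:: a; inr c].
Proof. by split; apply/negP=> /quadA[_] /=; rewrite ?andbF. Qed.

(** At a crease vertex there is at most one ordinary arrow in each direction,
    as the crease loop takes one of the two places, and their composite is a
    relation, as the composite with the crease loop is none. Hence every passage
    is forced through the crease loop. *)
Lemma crease_not_allowed x y : adjacent (of_ordinary x) (of_ordinary y) ->
  turning y -> ~~ allowed (of_ordinary x) (of_ordinary y).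
Proof.
rewrite /turning => adj cr; set v := ssrc (of_ordinary y) in adj cr.
have [c ec] : exists c : cvertex A, val c = v by exists (Sub v cr); rewrite SubK.
have three (P : {set arrow A}) a b : #|P| <= 2 -> inr c \in P -> inl a \in P ->
    inl b \in P -> a = b.
  move=> P2 Pc Pa Pb; apply/eqP; apply: contraLR P2 => nab; rewrite -ltnNge.
  have u3 : uniq [:: (inr c : arrow A); inl a; inl b].
    by rewrite /= !inE /= (inj_eq (@inl_inj _ _)) nab.
  have /subset_leq_card : [:: (inr c : arrow A); inl a; inl b] \subset P.
    by apply/fintype.subsetP => d; rewrite !inE => /or3P[] /eqP->.
  by rewrite (card_uniqP u3).
have two (P : {set arrow A}) a : #|P| <= 1 -> inr c \in P -> inl a \in P -> False.
  by move=> /card_le1_eqP P1 Pc Pa; have := P1 _ _ Pc Pa.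
have [fs ft] := fg1 fgA v.
rewrite /allowed; case: x y @v adj cr ec fs ft => [a []] [b []];
  rewrite /of_ordinary /adjacent /ssrc /stgt /= => /eqP adj cr ec fs ft.
- have [_ f2] := fg2 fgA b; apply/negP => /and3P[_ /negP nb _]; apply: nb.
  rewrite /banned /=; apply/negPn/negP => nZ.
  apply: (two _ a f2); rewrite inE /= ?ec ?adj eqxx //=.
  by case: (Z1_crease c (inl b)).
- rewrite (three _ a b fs) ?inE /= ?ec ?adj ?eqxx //.
- rewrite (three _ a b ft) ?inE /= ?ec ?adj ?eqxx //.
have [f2 _] := fg2 fgA b; apply/negP => /and3P[_ /negP nb _]; apply: nb.
rewrite /banned /= orbF; apply/negPn/negP => nZ.
apply: (two _ a f2); rewrite inE /= ?ec ?adj eqxx //=.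
by case: (Z1_crease c (inl b)).
Qed.

Lemma onextE x y : ~~ turning y ->
  onext x y = follows (of_ordinary x) (of_ordinary y).
Proof. by rewrite /onext /follows => /negbTE ->. Qed.

Lemma follows_turning x (y : symbol A) : follows (of_ordinary x) y ->
  crease A (ssrc y) = crease_symbol y.
Proof.
case: (symbol_cases y) => [[z -> _] |[c [ey cy _]] _].
  case/andP=> adj; apply: contraTF => /(crease_not_allowed adj).
  exact.
by rewrite cy; apply: crease_symbol_vertex.
Qed.

Lemma follows_to_crease x (c : cvertex A) e :
  follows (of_ordinary x) (inr c, e) = (stgt (of_ordinary x) == val c).
Proof.
rewrite /follows /adjacent /allowed banned_crease //=.
by case: e; rewrite /ssrc /= andbT.
Qed.

Lemma follows_from_crease x (c : cvertex A) e :
  follows (inr c, e) (of_ordinary x) = (val c == ssrc (of_ordinary x)).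
Proof.
by rewrite /follows /adjacent /allowed banned_crease //=; case: e; rewrite /stgt /= andbT.
Qed.

Lemma path_expand x (s : seq osym) :
  path (@follows K A) (of_ordinary x) (expand s) = path onext x s.
Proof.
elim: s x => // y s IHs x; rewrite expand_cons cat_path /= IHs.
case: (creasesP (ssrc (of_ordinary y))) => [[cr [c ec ->]]|[ncr ->]] /=.
  rewrite follows_to_crease follows_from_crease ec eqxx andbT /onext /turning cr.
  by rewrite /adjacent andbT.
by rewrite onextE.
Qed.

Lemma sorted_expand (s : seq osym) :
  sorted (@follows K A) (expand s) = sorted onext s.
Proof.
case: s => // y s; rewrite expand_cons.
case: (creasesP (ssrc (of_ordinary y))) => [[cr [c ec ->]]|[ncr ->]] /=.
  by rewrite follows_from_crease ec eqxx path_expand.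
by rewrite path_expand.
Qed.

Lemma cycle_expand (s : seq osym) :
  cycle (@follows K A) (expand s) = cycle onext s.
Proof.
case: s => // y s; rewrite /= -path_expand -cats1 expand_cat expand_cons.
rewrite (cyc_cycle _ (s := of_ordinary y :: (expand s ++ creases (ssrc (of_ordinary y))))).
  by rewrite /= -cats1 -catA expand_cons.
by apply/cycP; exists (of_ordinary y :: expand s), (creases (ssrc (of_ordinary y))).
Qed.

(** Deleting and restoring crease symbols: the two corrections are the crease
    symbol missing at a crease vertex where the word starts or ends with an
    ordinary symbol. *)
Lemma expand_core v s : is_walk v s -> sorted (@follows K A) s ->
  (if head false (map (@crease_symbol K A) s) then [::] else creases v) ++
    map (@forget_sign K A) s =
  expand (core s) ++ (if last true (map (@crease_symbol K A) s)
                      then creases (last v (map (@stgt K A) s)) else [::]).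
Proof.
elim: s v => [|y s IHs] v; first by rewrite /= cats0.
rewrite [is_walk _ _]/= => /andP[/eqP <- ws] py.
have {IHs ws} := IHs _ ws (path_sorted py); case: y py => [[a|c] e] py IHs.
  rewrite -[(inl a, e)]/(of_ordinary (a, e)) in py IHs *.
  rewrite core_of expand_cons -catA; congr (_ ++ _); congr (_ :: _).
  case: s py IHs => [//|z s] py; apply: etrans; have /andP[/follows_turning xz _] := py.
  rewrite [head _ _]/=; case: ifP xz => // _ ncz; move: py; rewrite /= => /andP[].
  case/andP=> /eqP -> _ _; case: (creasesP (ssrc z)) => [[]|[_ ->]] //.
  by rewrite ncz.
apply: etrans IHs.
have -> : head false (map (@crease_symbol K A) s) = false.
  case: s py => //= z s /andP[/follows_crease]; rewrite /crease_symbol /=.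
  by move/negbTE.
have -> : stgt (inr c : arrow A, e) = val c by case: (e).
by rewrite /creases valK.
Qed.

(** * Strings of a folded gentle triple *)

Definition core_word (w : word A) : vertex A * seq osym := (w.1, core w.2).

Definition core_tgt v (s : seq osym) := last v [seq stgt (of_ordinary x) | x <- s].

Definition core_start v (s : seq osym) :=
  if s is x :: _ then ssrc (of_ordinary x) == v else true.

Definition of_core v (s : seq osym) : word A :=
  (v, expand s ++ creases (core_tgt v s)).

Lemma core_tgtE v s : is_walk v s ->
  last v [seq stgt i | i <- s] = core_tgt v (core s).
Proof.
elim: s v => // y s IHs v /= /andP[/eqP <- /IHs ->].
case: y => [[a|c] e] //; by case: e.
Qed.

Lemma start_expand v (s : seq osym) t : s <> [::] ->
  starts_at (v, expand s ++ t) = core_start v s.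
Proof.
case: s => // x s _; rewrite expand_cons.
by case: (creasesP (ssrc (of_ordinary x))) => [[_ [c ec ->]]|[_ ->]];
  rewrite /starts_at /= -?ec.
Qed.

Lemma unsigned_sorted (w : word A) :
  sorted (@follows K A) (unsigned w) = sorted (@follows K A) w.2.
Proof.
rewrite /unsigned sorted_map; apply: eq_sorted => x y /=; exact: forget_follows.
Qed.

Lemma string_unsigned (w : word A) : is_string w ->
  unsigned w = expand (core w.2) ++ creases (core_tgt w.1 (core w.2)).
Proof.
move=> sw; have [ww _ _ [hs ht]] := sw; have [_ fw _] := (string_iff quadA w).1 sw.
have := expand_core ww fw; rewrite /wsrc /wtgt -(core_tgtE ww) in hs ht *.
have -> : (if head false (map (@crease_symbol K A) w.2) then [::]
           else creases w.1) = [::].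
  rewrite -hs; case: (boolP (crease A w.1)) => // nc.
  by case: (creasesP w.1) => [[]|[]//]; rewrite (negbTE nc).
rewrite /unsigned => /= ->; congr (_ ++ _); case: w {sw ww fw} hs ht => v [//|y s] _ /= ht.
rewrite -ht; case: ifP => // /negbT nc.
by case: (creasesP (last (stgt y) (map (@stgt K A) s))) => [[]|[]//];
  rewrite (negbTE nc).
Qed.

Lemma string_core (w : word A) : is_string w ->
  core_start w.1 (core w.2) /\ sorted onext (core w.2).
Proof.
move=> sw; have [st fw _] := (string_iff quadA w).1 sw.
have nw := string_unsigned sw; split; last first.
  by rewrite -unsigned_sorted nw in fw; case/cat_sorted2: fw => + _; rewrite sorted_expand.
case ew : (core w.2) => [//|x s]; rewrite -ew.
have w0 : core w.2 <> [::] by rewrite ew.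
rewrite -(start_expand w.1 (creases (core_tgt w.1 (core w.2)))) // -nw.
move: st; rewrite /starts_at /unsigned; case: (w) => v [|y t] //=.
by rewrite ssrc_forget.
Qed.

Lemma core_of_core v (s : seq osym) : core_word (of_core v s) = (v, s).
Proof.
rewrite /core_word /of_core /= core_cat core_expand.
by rewrite core_creases cats0.
Qed.

Lemma string_of_core v (s : seq osym) :
  core_start v s -> sorted onext s -> is_string (of_core v s).
Proof.
move=> sv so; apply/(string_iff quadA).
have walk : is_walk v (map of_ordinary s).
  rewrite is_walkE; apply/andP; split; first by case: (s) sv.
  by rewrite sorted_map; apply: sub_sorted so => x y /andP[].
case: (boolP (nilp s)) sv so walk => [/nilP -> _ _ _|].
  rewrite /of_core /starts_at /S3 /wsrc /wtgt /=.
  case: (creasesP v) => [[cv [c ec ->]]|[/negbTE cv ->]] /=; last by rewrite cv.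
  by rewrite -ec in cv *; split=> //; apply: eqxx.
case/lastP: s => // s x _ sv so walk.
have tgt : core_tgt v (rcons s x) = stgt (of_ordinary x).
  by rewrite /core_tgt map_rcons last_rcons.
have s0 : rcons s x <> [::] by case: (s).
have [t et] : exists t, expand (rcons s x) = rcons t (of_ordinary x).
  exists (expand s ++ creases (ssrc (of_ordinary x))).
  by rewrite -cats1 expand_cat expand_cons -cats1 catA.
have hd : crease A v = head false (map (@crease_symbol K A) (expand (rcons s x))).
  case: (rcons s x) sv s0 => // y s' /eqP <- _; rewrite expand_cons.
  by case: (creasesP (ssrc (of_ordinary y))) => [[-> [c _ ->]]|[/negbTE -> ->]].
have so' : sorted (@follows K A) (rcons t (of_ordinary x)) by rewrite -et sorted_expand.
split; first by rewrite /of_core start_expand.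
  rewrite /of_core tgt /= et cat_rcons sorted_cat_cons so' /=.
  case: (creasesP (stgt (of_ordinary x))) => [[_ [c ec ->]]|[_ ->]] //=.
  by rewrite follows_to_crease ec eqxx.
rewrite /S3 /wsrc /wtgt /of_core /= tgt; split.
  by rewrite hd et; case: (t).
rewrite et !map_cat !map_rcons !last_cat !last_rcons.
case: (creasesP (stgt (of_ordinary x))) => [[cr [c ec ->]]|[/negbTE ncr ->]] //=.
by rewrite -ec in cr.
Qed.

(** Two strings of a folded gentle triple that agree up to signs of crease
    symbols have the same core, and conversely. *)
Lemma string_sim2 (w w' : word A) : is_string w -> is_string w' ->
  sim2 w w' <-> core_word w = core_word w'.
Proof.
move=> sw sw'; split=> [[e1 e2]|[e1 e2]].
  by rewrite /core_word e1 -(core_forget w.2) e2 core_forget.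
by split=> //; rewrite -!/(unsigned _) !string_unsigned // e1 e2.
Qed.

Definition core_inv (c : vertex A * seq osym) : vertex A * seq osym :=
  (core_tgt c.1 c.2, revmap oinv c.2).

Lemma core_winv (w : word A) : is_word w -> core_word (winv w) = core_inv (core_word w).
Proof.
by move=> ww; rewrite /core_word /winv /wtgt /= core_tgtE // core_revmap.
Qed.

Lemma string_winv (w : word A) : is_string w -> is_string (winv w).
Proof.
move=> sw; have [ww _ _ [hs ht]] := sw; have [_ fw _] := (string_iff quadA w).1 sw.
apply/(string_iff quadA); split; first exact: winv_starts.
  by rewrite (@sorted_revmap _ (@follows K A) _ w.2) //; apply: follows_sinv.
have crev : map (@crease_symbol K A) (winv w).2 = rev (map (@crease_symbol K A) w.2).
  by rewrite /winv /= map_rev -map_comp.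
rewrite /S3 (wtgt_winv ww) crev hs; split; last first.
  by case: (map _ _) => //= b l; rewrite rev_cons last_rcons.
rewrite -[wsrc _]/(wtgt w) ht; case/lastP: (map _ _) => //= l b.
by rewrite rev_rcons last_rcons.
Qed.

Lemma string_equiv (w w' : word A) : is_string w -> is_string w' ->
  word_equiv w w' <->
  core_word w' = core_word w \/ core_word w' = core_inv (core_word w).
Proof.
move=> sw sw'; have [ww _ _ _] := sw; split.
  case=> w1 [[->|->]] e; have s1 := string_winv sw.
    by left; apply/esym/string_sim2.
  by right; rewrite -core_winv //; apply/esym/string_sim2.
case=> e; first by exists w; split; [left | apply/string_sim2].
exists (winv w); split; first by right.
by apply/string_sim2; [apply: string_winv | | rewrite core_winv].
Qed.

Lemma symmetric_string_core (w : word A) : is_string w ->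
  symmetric_string w <->
  ((core_word w).2 <> [::] \/ crease A w.1) /\ core_word w = core_inv (core_word w).
Proof.
move=> sw; have [ww _ _ _] := sw.
have sp : ~ simple w <-> ((core_word w).2 <> [::] \/ crease A w.1).
  rewrite /simple; split=> [w0|+ w0].
    apply: contrapT => no; apply: w0; have := string_unsigned sw.
    case ec : (core w.2) => [|x s]; last by case: no; left; rewrite /= ec.
    case: (creasesP w.1) => [[cr _]|[_ /= ->]]; first by case: no; right.
    by rewrite /unsigned; case: w.2.
  rewrite /= w0; case=> //; have [_ _ _ [+ _]] := sw.
  by rewrite w0 => ->.
by rewrite /symmetric_string (string_sim2 sw (string_winv sw)) core_winv // sp.
Qed.

(** * Bands of a folded gentle triple *)

Lemma expand_core_cycle v s : is_walk v s -> s <> [::] -> cycle (@follows K A) s ->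
  ~~ last true (map (@crease_symbol K A) s) ->
  map (@forget_sign K A) s = expand (core s).
Proof.
move=> ws; have := expand_core ws; case: s ws => // y s ws ec _ cs ls.
have sy : sorted (@follows K A) (y :: s).
  by move: cs; rewrite /= rcons_path => /andP[].
move: (ec sy); rewrite (negbTE ls) cats0 => <-.
move: cs ls; rewrite /= rcons_path last_map => /andP[_].
case: (symbol_cases (last y s)) => [[x -> _] ly _|[c [_ -> //]]].
have := follows_turning ly; have /andP[/eqP <- _] := ws.
case: crease_symbol => //.
by case: (creasesP (ssrc y)) => [[-> ]|[_ ->]].
Qed.

(** If a band ends with a crease symbol, this symbol belongs in front of the first
    ordinary one. *)
Lemma normalize_cycle s : s <> [::] -> cycle (@follows K A) s ->
  exists n, rot n (map (@forget_sign K A) s) =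
            expand (core (rot n (map (@forget_sign K A) s))).
Proof.
suff last_ord t : t <> [::] -> cycle (@follows K A) t ->
    ~~ last true (map (@crease_symbol K A) t) ->
    map (@forget_sign K A) t = expand (core t).
  move=> s0 cs; have [ls|ls] := boolP (last true (map (@crease_symbol K A) s)).
    case/lastP: s s0 cs ls => // s y _ cs; rewrite map_rcons last_rcons => cy.
    exists (size s); rewrite -map_rot core_forget -cats1 rot_size_cat.
    apply: last_ord => //; first by rewrite -rot_size_cat cats1 rot_cycle.
    case/lastP: s cs => [|s z]; first by rewrite /= andbT => /follows_crease; rewrite cy.
    rewrite -(rot_cycle (size (rcons s z))) -[rcons _ y]cats1 rot_size_cat /=.
    rewrite rcons_path last_rcons.
    case/andP=> _ /follows_crease; rewrite cy andbT => ncz.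
    by rewrite map_rcons last_rcons.
  by exists 0; rewrite rot0 core_forget last_ord.
case: t => // y t _ ct lt; apply: (@expand_core_cycle (ssrc y)) => //.
rewrite is_walkE /starts_at /= eqxx.
move: ct; rewrite /= rcons_path => /andP[+ _].
by apply: sub_path => z t' /andP[].
Qed.

Lemma cyc_core_unsigned (w : word A) : is_band w ->
  exists2 s, cyc (core w.2) s & cyc (unsigned w) (expand s).
Proof.
move=> bw; have [_ cw _] := (band_iff quadA w).1 bw.
have [|n en] := normalize_cycle (band_neq0 bw); first by rewrite -unsigned_cycle.
exists (core (rot n (unsigned w))); last by rewrite -en; apply: cyc_rot.
by rewrite -(core_forget w.2); apply/cyc_core/cyc_rot.
Qed.

Lemma cyc_unsigned_core (w w' : word A) : is_band w -> is_band w' ->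
  cyc (unsigned w) (unsigned w') <-> cyc (core w.2) (core w'.2).
Proof.
move=> bw bw'; split=> [/cyc_core|]; first by rewrite !core_forget.
have [s ws us] := cyc_core_unsigned bw; have [s' ws' us'] := cyc_core_unsigned bw'.
move=> ww'; have ss' : cyc s s'.
  exact: cyc_trans (cyc_sym ws) (cyc_trans ww' ws').
exact: cyc_trans us (cyc_trans (cyc_expand ss') (cyc_sym us')).
Qed.

Lemma core_band (w : word A) : is_band w -> band onext (core w.2).
Proof.
move=> bw; have [_ cw pw] := (band_iff quadA w).1 bw.
have [s ws us] := cyc_core_unsigned bw.
apply: (band_cyc (cyc_sym ws)); split.
  by rewrite -cycle_expand (cyc_cycle _ us).
by apply/primitive_expand/(primitive_cyc us).
Qed.

Lemma band_of_core (s : seq osym) : band onext s ->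
  exists2 w : word A, is_band w & core w.2 = s.
Proof.
case=> cs ps; have [s0 _] := ps; case: s s0 cs ps => // x s _ cs ps.
exists (ssrc (of_ordinary x), expand (x :: s)); last by rewrite core_expand.
have eu : unsigned (ssrc (of_ordinary x), expand (x :: s)) = expand (x :: s).
  exact: expand_forget.
apply/(band_iff quadA); rewrite eu cycle_expand; split=> //.
  by rewrite -[expand _]cats0 start_expand //= eqxx.
exact/primitive_expand.
Qed.

Lemma band_equiv_core (w w' : word A) : is_band w -> is_band w' ->
  band_equiv w w' <-> ceq oinv (core w.2) (core w'.2).
Proof.
move=> bw bw'; have bv := band_winv quadA bw.
rewrite /ceq -core_revmap (band_equiv_iff quadA) // cyc_unsigned_core //.
by rewrite cyc_unsigned_core //; tauto.
Qed.

Lemma symmetric_band_core (w : word A) : is_band w ->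
  symmetric_band w <-> reversible oinv (core w.2).
Proof.
move=> bw; rewrite /reversible -core_revmap (symmetric_band_iff quadA) //.
exact: cyc_unsigned_core (band_winv quadA bw).
Qed.

Lemma ncrease_core (w : word A) : is_band w ->
  odd (ncrease w) = parity turning (core w.2).
Proof.
move=> bw; have [s ws us] := cyc_core_unsigned bw.
rewrite -(parity_cyc turning ws) /parity -count_crease_expand.
have -> : ncrease w = count (@crease_symbol K A) (unsigned w).
  by rewrite /ncrease count_map; apply: eq_count => y /=; rewrite crease_forget.
exact/esym/(parity_cyc (@crease_symbol K A) us).
Qed.

End Ordinary.

(** * The unfolding as a double cover *)

Section Unfolding.
Variables (K : fieldType) (A : triple K).
Local Notation U := (unfolding A).
Local Notation osym := (oarrow A * bool)%type.
Local Notation csym := (osym * bool)%type.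
Local Notation onext := (@onext K A).
Local Notation turning := (@turning K A).
Local Notation cover_next := (cover_next turning onext).
Local Notation cover_inv := (cover_inv (@oinv K A)).
Implicit Types (x y : csym) (w : word U).

Definition of_cover x : symbol U := (inl (x.1.1, x.2), x.1.2).

(** The unfolding has no crease loops, so the second case is contradictory. *)
Definition to_cover (y : symbol U) : csym :=
  match y.1 with
  | inl a => ((a.1, y.2), a.2)
  | inr c => False_rect csym (notF (valP c))
  end.

Definition cover_word w := map to_cover w.2.

Lemma of_coverK : cancel of_cover to_cover.
Proof. by case=> [[a e] i]. Qed.

Lemma to_coverK : cancel to_cover of_cover.
Proof. by case=> [[[a i]|[c cc]] e] //; case: (notF cc). Qed.

Lemma unfolding_crease_symbol (y : symbol U) : crease_symbol y = false.
Proof. by case: y => [[a|[c cc]] e] //; case: (notF cc). Qed.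

Lemma unfolding_unsigned w : unsigned w = w.2.
Proof.
by rewrite /unsigned -[RHS]map_id; apply: eq_map => y;
  rewrite /forget_sign unfolding_crease_symbol.
Qed.

Lemma unfolding_quadratic : quadratic U.
Proof.
by move=> [|[[a i]|c] [|[[b j]|c'] [|d p]]] //.
Qed.

Lemma hatv_eq (u v : vertex A) i j :
  (hatv u i == hatv v j) = (u == v) && (crease A v || (i == j)).
Proof.
rewrite -val_eqE /= xpair_eqE; case: eqVneq => //= ->.
by case: crease; case: i; case: j.
Qed.

Lemma gvertex_hatv (v : vertex A) i : gvertex (hatv v i) = hatv v (~~ i).
Proof.
by apply/eqP; rewrite /gvertex /= hatv_eq eqxx; case: crease; case: i.
Qed.

Lemma gvertex_fixed (z : vertex U) : (gvertex z == z) = crease A (val z).1.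
Proof.
case: z => [[v i] vi]; rewrite -val_eqE /= xpair_eqE eqxx /=.
by case: crease vi; case: i.
Qed.

Lemma hatvK (z : vertex U) : z = hatv (val z).1 (val z).2.
Proof.
by apply/val_inj; case: z => [[v i] /=]; case: crease; case: i.
Qed.

Lemma ssrc_of_cover x : ssrc (of_cover x) = hatv (ssrc (of_ordinary x.1)) x.2.
Proof. by case: x => [[a []] i]. Qed.

Lemma stgt_of_cover x : stgt (of_cover x) = hatv (stgt (of_ordinary x.1)) x.2.
Proof. by case: x => [[a []] i]. Qed.

Lemma gsymbol_of_cover x : gsymbol (of_cover x) = of_cover (deck x).
Proof. by []. Qed.

Lemma to_cover_gsymbol (y : symbol U) : to_cover (gsymbol y) = deck (to_cover y).
Proof. by rewrite -{1}(to_coverK y) gsymbol_of_cover of_coverK. Qed.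

Lemma to_cover_sinv (y : symbol U) : to_cover (sinv y) = cover_inv (to_cover y).
Proof. by rewrite -{1}(to_coverK y) -[sinv _]/(of_cover (cover_inv _)) of_coverK. Qed.

Lemma ssrc_gsymbol (y : symbol U) : ssrc (gsymbol y) = gvertex (ssrc y).
Proof.
by rewrite -(to_coverK y) gsymbol_of_cover !ssrc_of_cover gvertex_hatv.
Qed.

Lemma cover_word_gword w : cover_word (gword w) = map deck (cover_word w).
Proof.
rewrite /cover_word /gword /= -!map_comp.
by apply: eq_map => y /=; apply: to_cover_gsymbol.
Qed.

Lemma cover_word_winv w : cover_word (winv w) = revmap cover_inv (cover_word w).
Proof.
rewrite /cover_word /winv /revmap /= map_rev -!map_comp; congr rev.
by apply: eq_map => y /=; apply: to_cover_sinv.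
Qed.

Lemma cover_wordK w : map of_cover (cover_word w) = w.2.
Proof. exact: mapK to_coverK _. Qed.

Lemma gword_starts w : starts_at w -> starts_at (gword w).
Proof.
by case: w => v [//|y s]; rewrite /starts_at /= => /eqP <-; rewrite ssrc_gsymbol.
Qed.

Hypothesis fgA : folded_gentle A.

(** At an ordinary vertex the sheet cannot change, and the conditions on
    consecutive symbols are those of the triple below; at a crease vertex they
    are violated on equal sheets and hold on distinct ones. *)
Lemma follows_of_cover x y : follows (of_cover x) (of_cover y) = cover_next x y.
Proof.
rewrite /follows /cover_next /adjacent ssrc_of_cover stgt_of_cover hatv_eq.
have -> : allowed (of_cover x) (of_cover y) =
    (x.2 != y.2) || allowed (of_ordinary x.1) (of_ordinary y.1).
  case: x y => [[a e] i] [[b f] j]; rewrite /allowed /banned /sinv /= /hat_Z1.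
  rewrite -!pair_eqE /= !(inj_eq (@inl_inj _ _)) -!pair_eqE /=.
  by rewrite [j == i]eq_sym; case: (eqVneq i j) => _ /=; rewrite ?andbT ?andbF //= !andbF.
rewrite /onext /adjacent; case: eqVneq => //= e.
rewrite -[crease A _]/(turning y.1).
have := @crease_not_allowed _ _ fgA x.1 y.1.
rewrite /adjacent e eqxx => /(_ isT).
case: (boolP (turning y.1)) => /= [_ /(_ isT)/negbTE ->|_ _]; last first.
  by rewrite addbF eq_sym; case: eqVneq; rewrite //= ?andbT ?andbF.
by rewrite orbF addbT; case: x.2; case: y.2.
Qed.

Lemma to_cover_next (y z : symbol U) :
  cover_next (to_cover y) (to_cover z) = follows y z.
Proof. by rewrite -follows_of_cover !to_coverK. Qed.

(** * Bands of the unfolding *)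

Lemma unfolding_band_iff w :
  is_band w <-> starts_at w /\ cover_band turning onext (cover_word w).
Proof.
have -> : is_band w <-> _ := band_iff unfolding_quadratic w.
rewrite unfolding_unsigned /cover_band /cover_word cycle_map.
rewrite (eq_cycle (e' := @follows K U)); last by move=> y z; apply: to_cover_next.
split=> [[sw cw pw]|[sw [cw pw]]]; split=> //.
  split=> //; apply: (@primitive_of_map _ _ of_cover).
  by rewrite cover_wordK.
exact: primitive_of_map pw.
Qed.

Lemma unfolding_band_equiv w w' : is_band w -> is_band w' ->
  band_equiv w w' <-> ceq cover_inv (cover_word w) (cover_word w').
Proof.
move=> bw bw'; rewrite (band_equiv_iff unfolding_quadratic) // !unfolding_unsigned.
have cyc_cover (v : word U) : cyc v.2 w'.2 <-> cyc (cover_word v) (cover_word w').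
  split=> [|/(cyc_map of_cover)]; first exact: cyc_map.
  by rewrite !cover_wordK.
by rewrite !cyc_cover cover_word_winv /ceq; tauto.
Qed.

Lemma band_gword w : is_band w -> is_band (gword w).
Proof.
move/unfolding_band_iff=> [sw bw]; apply/unfolding_band_iff.
by split; [apply: gword_starts | rewrite cover_word_gword; apply: cover_band_deck].
Qed.

Lemma band_of_cover_word (s : seq csym) : cover_band turning onext s ->
  exists2 w : word U, is_band w & cover_word w = s.
Proof.
move=> bs; have [_ [s0 _]] := bs; case: s s0 bs => // x s _ bs.
have cK : cover_word (ssrc (of_cover x), map of_cover (x :: s)) = x :: s.
  by rewrite /cover_word -map_comp -[RHS]map_id; apply: eq_map => y; apply: of_coverK.
exists (ssrc (of_cover x), map of_cover (x :: s)) => //.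
by apply/unfolding_band_iff; rewrite cK; split=> //; apply: eqxx.
Qed.

(** * Strings of the unfolding *)

Definition down_word w : vertex A * seq osym := ((val w.1).1, map fst (cover_word w)).

Lemma unfolding_string_iff w :
  is_string w <-> starts_at w /\ sorted cover_next (cover_word w).
Proof.
have -> : is_string w <-> _ := string_iff unfolding_quadratic w.
rewrite /cover_word sorted_map (eq_sorted (e' := @follows K U)); last first.
  by move=> y z; apply: to_cover_next.
split=> [[]|[sw fw]] //; split=> //; split.
  by case: w.2 => //= y s; rewrite unfolding_crease_symbol.
by case/lastP: w.2 => //= s y; rewrite map_rcons last_rcons unfolding_crease_symbol.
Qed.

Lemma string_gword w : is_string w -> is_string (gword w).
Proof.
case/unfolding_string_iff=> sw cw; apply/unfolding_string_iff.
split; first exact: gword_starts.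
rewrite cover_word_gword sorted_map; apply: sub_sorted cw => x y.
by rewrite /= cover_next_deck.
Qed.

Lemma unfolding_string_winv w : is_string w -> is_string (winv w).
Proof.
move=> sw; have [ww _ _ _] := sw; have [_ cw] := (unfolding_string_iff w).1 sw.
apply/unfolding_string_iff; split; first exact: winv_starts.
rewrite cover_word_winv sorted_revmap //.
by apply: cover_next_inv; [apply: onext_inv | apply: turning_inv].
Qed.

Lemma unfolding_word_equiv w w' : word_equiv w w' <-> w' = w \/ w' = winv w.
Proof.
have sim2E (v : word U) : sim2 v w' <-> w' = v.
  split=> [[e1]|->//]; rewrite -!/(unsigned _) !unfolding_unsigned => e2.
  by rewrite [w']surjective_pairing [v]surjective_pairing e1 e2.
split=> [[w1 [[->|->] /sim2E]]|[]] h; [by left|by right|..].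
  by exists w; split; [left | apply/sim2E].
by exists (winv w); split; [right | apply/sim2E].
Qed.

Lemma down_gword w : down_word (gword w) = down_word w.
Proof.
rewrite /down_word cover_word_gword fst_deck [in RHS](hatvK w.1).
by rewrite /= (hatvK w.1) gvertex_hatv.
Qed.

Lemma down_winv w : down_word (winv w) = core_inv (down_word w).
Proof.
rewrite /down_word cover_word_winv fst_revmap /core_inv /=; congr (_, _).
rewrite /wtgt -cover_wordK; elim/last_ind: (cover_word w) => //= s x _.
by rewrite !map_rcons /core_tgt map_rcons !last_rcons stgt_of_cover.
Qed.

Lemma string_down w : is_string w ->
  core_start (down_word w).1 (down_word w).2 /\ sorted onext (down_word w).2.
Proof.
case/unfolding_string_iff=> sw cw.
split; last by case: (sorted_cover cw).
move: sw; rewrite /starts_at /down_word -cover_wordK; case: (cover_word w) => //= x s.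
by rewrite ssrc_of_cover => /eqP <-.
Qed.

(** Given the projection, the first sheet determines all others. *)
Lemma down_eq w w' : is_string w -> is_string w' -> down_word w = down_word w' ->
  w' = w \/ w' = gword w.
Proof.
case/unfolding_string_iff=> sw cw /unfolding_string_iff[sw' cw'] [e1 e2].
case ew : (cover_word w) => [|x s].
  have w0 : w.2 = [::] by rewrite -cover_wordK ew.
  have w0' : w'.2 = [::].
    apply: size0nil; have := congr1 size e2.
    by rewrite /= /cover_word !size_map w0 => <-.
  have [e|ne] := eqVneq w'.1 w.1; [left|right].
    by rewrite [w']surjective_pairing [w]surjective_pairing e w0 w0'.
  rewrite [w']surjective_pairing /gword w0 w0' /=; congr (_, _).
  move: ne; rewrite (hatvK w'.1) (hatvK w.1) gvertex_hatv -e1 hatv_eq eqxx /=.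
  rewrite negb_or => /andP[_ ne]; congr hatv.
  by case: (_.2) ne; case: (_.2).
have w0 : w'.2 <> [::].
  move=> w0; move: e2; rewrite ew /cover_word w0 //.
have [_ [i e]] := sorted_cover cw; have [_ [j e']] := sorted_cover cw'.
have [ij|ij] : j = i \/ j = ~~ i by case: i j {e e'} => [] []; auto.
  left; apply: word_eq => //.
  by rewrite -[LHS]cover_wordK -[RHS]cover_wordK e e' ij e2.
right; apply: word_eq => //; first exact: gword_starts.
rewrite -[LHS]cover_wordK -[RHS]cover_wordK cover_word_gword e e' ij e2.
by rewrite deck_lift.
Qed.

Lemma string_lift v (s : seq osym) : core_start v s -> sorted onext s ->
  exists2 w : word U, is_string w & down_word w = (v, s).
Proof.
move=> sv so; exists (hatv v false, map of_cover (lift_word turning false s)).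
  apply/unfolding_string_iff; split.
    case: s sv {so} => //= x s /eqP <-.
    by rewrite /starts_at /= ssrc_of_cover hatv_eq eqxx /= /turning; case: crease.
  by rewrite /cover_word /= (mapK of_coverK) sorted_lift.
by rewrite /down_word /cover_word /= (mapK of_coverK) fst_lift.
Qed.

End Unfolding.

(** * Quotients by an involution *)

Lemma class_of_eq (T : Type) (R : T -> T -> Prop) :
  (forall x, R x x) -> (forall x y, R x y -> R y x) ->
  (forall x y z, R x y -> R y z -> R x z) ->
  forall x y, class_of R x = class_of R y <-> R x y.
Proof.
move=> Rx Rs Rt x y; split=> [/(congr1 (@proj1_sig _ _))/= e|xy].
  have : [set z | R y z]%classic y by apply: Rx.
  by rewrite -e.
apply: eq_exist; apply/predeqP => z /=; split; last exact: Rt.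
by apply: Rt; apply: Rs.
Qed.

Lemma class_of_repr (T : Type) (R : T -> T -> Prop) (C : Defs.quotient R) :
  exists x, C = class_of R x.
Proof. by case: C => C [x e]; exists x; apply: eq_exist. Qed.

Section OrbitQuotient.
Variables (X Y : Type) (RX : X -> X -> Prop) (RY : Y -> Y -> Prop).
Hypothesis RX_refl : forall x, RX x x.
Hypothesis RX_sym : forall x y, RX x y -> RX y x.
Hypothesis RX_trans : forall x y z, RX x y -> RX y z -> RX x z.
Hypothesis RY_refl : forall x, RY x x.
Hypothesis RY_sym : forall x y, RY x y -> RY y x.
Hypothesis RY_trans : forall x y z, RY x y -> RY y z -> RY x z.
Variables (g : X -> X) (f : X -> Y).
Hypothesis g_compat : forall x y, RX x y -> RX (g x) (g y).
Hypothesis gK : forall x, RX (g (g x)) x.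
Hypothesis f_surj : forall y, exists x, RY (f x) y.
Hypothesis f_fiber : forall x x', RY (f x) (f x') <-> RX x' x \/ RX x' (g x).

(** A map whose fibres are the orbits of an involution identifies the quotient
    by the involution with its target. *)
Lemma orbit_quotient : exists act : {action 'Z_2 &-> Defs.quotient RX},
  (forall x, act (class_of RX x) Z2gen = class_of RX (g x)) /\
  exists2 phi : orbits act -> Defs.quotient RY, bijective phi &
  exists rho : Defs.quotient RX -> Defs.quotient RY,
    [/\ forall C, rho C = phi (orbit_of act C), surjective_fun rho &
        forall x, rho (class_of RX x) = class_of RY (f x)].
Proof.
have classX := class_of_eq RX_refl RX_sym RX_trans.
have classY := class_of_eq RY_refl RY_sym RY_trans.
pose rep (T : Type) (R : T -> T -> Prop) (C : Defs.quotient R) :=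
  proj1_sig (cid (class_of_repr C)).
have repK T (R : T -> T -> Prop) C : class_of R (rep T R C) = C.
  by rewrite /rep; case: cid => x /= ->.
pose G (C : Defs.quotient RX) : Defs.quotient RX := class_of RX (g (rep _ _ C)).
have GE x : G (class_of RX x) = class_of RX (g x).
  by apply/classX/g_compat/classX; rewrite repK.
have GK : involutive G.
  by move=> C; rewrite -(repK _ _ C) !GE; apply/classX.
pose to (C : Defs.quotient RX) (a : 'Z_2) := iter (a : nat) G C.
have to1 : to^~ 1%g =1 id by [].
have toM C : act_morph to C.
  move=> [[|[|//]] ?] [[|[|//]] ?] //.
  by rewrite /to /= GK.
pose act := TotalAction to1 toM.
have orb (C D : Defs.quotient RX) : orbit_rel act C D <-> D = C \/ D = G C.
  split=> [[[[|[|//]] ?] ->]|[->|->]]; [by left|by right|by exists 0%R|].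
  by exists Z2gen.
pose rho (C : Defs.quotient RX) : Defs.quotient RY := class_of RY (f (rep _ _ C)).
have rhoE x : rho (class_of RX x) = class_of RY (f x).
  by apply/classY/f_fiber; left; apply/classX; rewrite repK.
have rhoG C : rho (G C) = rho C.
  rewrite -(repK _ _ C) GE !rhoE; apply/classY/f_fiber.
  by right; apply/RX_sym/gK.
have classO C D : orbit_of act C = orbit_of act D <-> D = C \/ D = G C.
  apply: iff_trans (orb C D); apply: class_of_eq => {C D}.
  - by move=> C; apply/orb; left.
  - by move=> C D /orb[->|->]; apply/orb; [left | right; rewrite GK].
  by move=> C D E /orb[->|->] /orb[->|->]; apply/orb; rewrite ?GK; auto.
pose phi (O : orbits act) := rho (rep _ _ O).
have phiE C : rho C = phi (orbit_of act C).
  rewrite /phi; have /classO[<-|e] := repK _ _ (orbit_of act C) => //.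
  by rewrite {1}e rhoG.
have rho_surj D : exists C, rho C = D.
  have [x fx] := f_surj (rep _ _ D); exists (class_of RX x).
  by rewrite rhoE -(repK _ _ D); apply/classY.
exists act; split; first by move=> x; rewrite -GE.
exists phi; last by exists rho.
exists (fun D => orbit_of act (proj1_sig (cid (rho_surj D)))) => [O|D]; last first.
  by rewrite -phiE; case: cid.
case: cid => C /= e; apply: etrans (repK _ _ O); apply: (classO _ _).2.
move: e; rewrite /phi; move: (rep _ _ O) => D.
rewrite -(repK _ _ C) -(repK _ _ D) !rhoE GE.
by case/classY/f_fiber => /classX ->; auto.
Qed.

End OrbitQuotient.

(** * Halves of bands *)

Section Halves.
Variables (K : fieldType) (A : triple K).
Hypothesis fgA : folded_gentle A.
Local Notation U := (unfolding A).
Local Notation onext := (@onext K A).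
Local Notation turning := (@turning K A).
Local Notation cover_next := (cover_next turning onext).
Local Notation cover_inv := (cover_inv (@oinv K A)).
Implicit Types (u w : word U).

Let quadU := unfolding_quadratic (A := A).

Lemma subword_word (B : triple K) (u w : word B) :
  is_word w -> subword u w -> is_word u.
Proof.
move=> ww [p [q [ew eu]]]; move: ww; rewrite /is_word ew !is_walk_cat.
by rewrite -[last _ _]/(wtgt (w.1, p)) -eu => /and3P[].
Qed.

Lemma wtgt_gword w : wtgt (gword w) = gvertex (wtgt w).
Proof.
case: w => v s; rewrite /wtgt /=; elim/last_ind: s => //= s y _.
rewrite !map_rcons !last_rcons -(to_coverK y) gsymbol_of_cover.
by rewrite !stgt_of_cover gvertex_hatv.
Qed.

Lemma gword_word w : is_word w -> is_word (gword w).
Proof.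
rewrite /is_word; case: w => v s /=; elim: s v => //= y s IHs v.
case/andP=> /eqP <- /IHs; rewrite ssrc_gsymbol eqxx /=.
rewrite -(to_coverK y) gsymbol_of_cover !stgt_of_cover gvertex_hatv //.
Qed.

Lemma gsymbolK : involutive (@gsymbol K A).
Proof. by case=> [[[a i]|c] e]; rewrite /gsymbol /= ?negbK. Qed.

Lemma gwordK : involutive (@gword K A).
Proof.
case=> v s; rewrite /gword /= (mapK gsymbolK) (hatvK v) !gvertex_hatv negbK //.
Qed.

Lemma gword_winv w : gword (winv w) = winv (gword w).
Proof.
by rewrite {1}/gword /= -wtgt_gword /winv /= map_rev -!map_comp.
Qed.

Lemma gsymbol_neq (y : symbol U) : gsymbol y != y.
Proof.
apply/eqP => /(congr1 (@to_cover K A)); rewrite to_cover_gsymbol => /eqP.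
by case: (to_cover y) => x []; rewrite -pair_eqE /= andbF.
Qed.

Lemma cover_band_reduced s : cover_band turning onext s ->
  sorted (fun x y => x != sinv y) (map (@of_cover K A) s).
Proof.
case=> cs _; have : sorted (@follows K U) (map (@of_cover K A) s).
  rewrite sorted_map -(power1 s); apply: sorted_power.
  by rewrite -(eq_cycle (e := cover_next)) // => x y; rewrite /= follows_of_cover.
by apply: sub_sorted => x y /andP[_ /and3P[]].
Qed.

Lemma reduced_gword u : reduced u -> reduced (gword u).
Proof.
move=> ru; rewrite /reduced /gword /= sorted_map; apply: sub_sorted ru => x y /=.
rewrite -[sinv (gsymbol y)]/(gsymbol (sinv y)) => /negP n.
by apply/eqP => /(inv_inj gsymbolK) e; apply: n; rewrite e.
Qed.

(** If the last symbol of gu cancelled against the first one of u, then so would,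
    by the symmetry g, the last symbol of the reduction against its first one. *)
Lemma wcat_gword u : reduced u -> is_band (wcat (gword u) u) ->
  (wcat (gword u) u).2 = (gword u).2 ++ u.2.
Proof.
move=> ru bz; have rg := reduced_gword ru.
have [_ cz _] := (band_iff quadU _).1 bz; have z0 := band_neq0 bz.
rewrite unfolding_unsigned /wcat in cz z0 *.
change (red ((gword u).2 ++ u.2) <> [::]) in z0.
change (is_true (cycle (@follows K U) (red ((gword u).2 ++ u.2)))) in cz.
change (red ((gword u).2 ++ u.2) = (gword u).2 ++ u.2).
have [[|x p] [s1 [t1 [es et er]]]] := red_cat_split rg ru.
  by rewrite er es et cats0.
have sz : size s1 = size t1.
  have /eqP : size (gword u).2 = size u.2 by rewrite size_map.
  by rewrite es et !size_cat size_revmap addnC eqn_add2l => /eqP.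
rewrite er in cz z0; case: s1 es sz cz z0 {er} => [|a s1] es sz cz z0.
  by case: t1 {et cz} sz z0.
case/lastP: t1 et sz cz {z0} => [|t1 b] // et sz cz.
have ea : a = gsymbol x by move: es; rewrite /= et => -[].
have eb : gsymbol b = sinv x.
  have : last b (gword u).2 = gsymbol b.
    by rewrite /= et -rcons_cat map_rcons last_rcons.
  by rewrite es last_cat /revmap /= rev_cons last_rcons => <-.
move: cz; rewrite /= rcons_path last_cat last_rcons => /andP[_].
have -> : b = sinv a by rewrite ea -[b]gsymbolK eb.
by rewrite /follows /allowed eqxx andbF.
Qed.

(** At the junction the inverse of gy meets y, and gy differs from y. *)
Lemma wcat_winv_gword u : reduced u ->
  (wcat (winv (gword u)) u).2 = (winv (gword u)).2 ++ u.2.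
Proof.
move=> ru; have rg : sorted (fun x y => x != sinv y) (winv (gword u)).2.
  rewrite (@sorted_revmap _ (fun x y => x != sinv y) _ (gword u).2).
    exact: reduced_gword.
  by move=> x y /=; rewrite sinvK eq_sym.
apply: red_id; case: u ru rg => v [|y s] ru rg.
  by rewrite /= in rg *.
move: rg; rewrite /gword /winv /= rev_cons => rg.
by rewrite cat_rcons sorted_cat_cons rg /= (inj_eq (inv_inj (@sinvK K U))) gsymbol_neq.
Qed.

(** Transports a decomposition of a band of the unfolding into two halves to the
    cover; h is either g or g followed by inversion. *)
Lemma halves_iff (h : word U -> word U) (hc : seq _ -> seq _) w :
  (forall u, cover_word (h u) = hc (cover_word u)) ->
  (forall u, is_word u -> is_word (h u)) ->
  (forall u, size (h u).2 = size u.2) ->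
  (forall u, reduced u -> is_band (wcat (h u) u) ->
     (wcat (h u) u).2 = (h u).2 ++ u.2) ->
  is_band w ->
  (exists2 u, subword u w & band_equiv w (wcat (h u) u)) <->
  (exists2 c, infix_of (cover_word w) c &
     cover_band turning onext (hc c ++ c) /\ ceq cover_inv (cover_word w) (hc c ++ c)).
Proof.
move=> hE hw hs hcat bw; have [ww _ [_ /(_ 1)[rw _]] _] := bw.
split=> [[u uw ewz]|[c [p [q ec]] [bc wc]]].
  have ru : reduced u.
    have [p [q [ew _]]] := uw; move: rw; rewrite /S1 /reduced /= cats0 ew.
    by case/cat_sorted2=> _ /cat_sorted2[].
  have bz : is_band (wcat (h u) u).
    by have [] := (band_equiv_iff quadU _ bw).1 ewz.
  have cz : cover_word (wcat (h u) u) = hc (cover_word u) ++ cover_word u.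
    by rewrite /cover_word hcat // map_cat -!/(cover_word _) hE.
  exists (cover_word u).
    have [p [q [ew _]]] := uw; exists (map (@to_cover K A) p), (map (@to_cover K A) q).
    by rewrite /cover_word ew !map_cat.
  have [_ bc] := (unfolding_band_iff fgA _).1 bz; rewrite -cz; split=> //.
  by apply/(unfolding_band_equiv bw bz).
have ew : w.2 = map (@of_cover K A) p ++ map (@of_cover K A) c ++ map (@of_cover K A) q.
  by rewrite -!map_cat -ec cover_wordK.
pose u : word U := (wtgt (w.1, map (@of_cover K A) p), map (@of_cover K A) c).
have uw : subword u w by exists (map (@of_cover K A) p), (map (@of_cover K A) q).
have cu : cover_word u = c by rewrite /cover_word /= (mapK (@of_coverK K A)).
have e2 : (h u).2 ++ u.2 = map (@of_cover K A) (hc c ++ c).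
  by rewrite map_cat -{1}cu -hE cover_wordK.
have z2 : (wcat (h u) u).2 = (h u).2 ++ u.2.
  by apply: red_id; rewrite [X in sorted _ X]e2; apply: cover_band_reduced.
have bz : is_band (wcat (h u) u).
  apply/(unfolding_band_iff fgA); rewrite /cover_word z2 e2.
  rewrite (mapK (@of_coverK K A)); split=> //.
  have := hw _ (subword_word ww uw); rewrite /is_word is_walkE => /andP[+ _].
  have h0 : (h u).2 <> [::].
    move=> h0; have := hs u; rewrite h0 /= size_map => /esym/size0nil c0.
    case: bc => _ [z0 _]; apply/z0/size0nil.
    by rewrite -(size_map (@of_cover K A)) -e2 h0 /= c0.
  have -> : wcat (h u) u = ((h u).1, (h u).2 ++ u.2) by rewrite -z2.
  by rewrite /starts_at /=; case: (h u).2 h0.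
exists u => //; apply/(unfolding_band_equiv bw bz).
by rewrite [cover_word (wcat _ _)]/cover_word z2 e2 (mapK (@of_coverK K A)).
Qed.

End Halves.

(** * Folding strings *)

Section Folding.
Variables (K : fieldType) (A : triple K).
Hypothesis fgA : folded_gentle A.
Local Notation U := (unfolding A).
Local Notation onext := (@onext K A).
Local Notation turning := (@turning K A).
Local Notation oinv := (@oinv K A).
Local Notation cover_inv := (cover_inv oinv).

Let oinvK := @oinvK K A.
Let coverK := cover_invK oinvK.

Definition g_string (w : gstring U) : gstring U :=
  GString (string_gword fgA (stringP w)).

Definition g_band (w : gband U) : gband U := GBand (band_gword fgA (bandP w)).

Definition fold_string (w : gstring U) : gstring A :=
  let s := string_down fgA (stringP w) in
  GString (string_of_core fgA s.1 s.2).

Lemma core_fold_string (w : gstring U) :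
  core_word (fold_string w) = down_word w.
Proof. by rewrite core_of_core -surjective_pairing. Qed.

Lemma gstring_word (B : triple K) (w : gstring B) : is_word w.
Proof. by case: (stringP w). Qed.

Lemma string_rel_refl (B : triple K) (w : gstring B) : string_rel w w.
Proof. exact: word_equiv_refl. Qed.

Lemma string_rel_sym (B : triple K) (w w' : gstring B) :
  string_rel w w' -> string_rel w' w.
Proof. exact/word_equiv_sym/gstring_word. Qed.

Lemma string_rel_trans (B : triple K) (u v w : gstring B) :
  string_rel u v -> string_rel v w -> string_rel u w.
Proof. exact/word_equiv_trans/gstring_word. Qed.

Lemma g_string_compat (w w' : gstring U) :
  string_rel w w' -> string_rel (g_string w) (g_string w').
Proof.
case/unfolding_word_equiv=> e; apply/unfolding_word_equiv; rewrite /= e.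
  by left.
by right; rewrite gword_winv.
Qed.

Lemma g_stringK (w : gstring U) : string_rel (g_string (g_string w)) w.
Proof. by apply/unfolding_word_equiv; left; rewrite /= gwordK. Qed.

Lemma fold_string_surj (r : gstring A) : exists w, string_rel (fold_string w) r.
Proof.
have [cs so] := string_core fgA (stringP r).
have [w sw dw] := string_lift fgA cs so; exists (GString sw).
apply/(string_equiv fgA (stringP _) (stringP r)); left.
by rewrite core_fold_string dw.
Qed.

Lemma fold_string_fiber (w w' : gstring U) :
  string_rel (fold_string w) (fold_string w') <->
  string_rel w' w \/ string_rel w' (g_string w).
Proof.
have ww := gstring_word w; have ww' := gstring_word w'.
apply: (iff_trans (string_equiv fgA (stringP _) (stringP _))).
rewrite !core_fold_string -down_winv; split=> [[e|e]|[|]].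
- have [e1|e1] := down_eq fgA (stringP w) (stringP w') (esym e); [left|right].
    by apply/unfolding_word_equiv; left.
  by apply/unfolding_word_equiv; left.
- have sv := unfolding_string_winv fgA (stringP w).
  have [e1|e1] := down_eq fgA sv (stringP w') (esym e); [left|right];
    apply/unfolding_word_equiv; right; rewrite e1 ?winvK //.
  by rewrite /= gword_winv winvK // gword_word.
- by case/unfolding_word_equiv=> e; [left | right]; rewrite e ?winvK.
case/unfolding_word_equiv=> /= e; [left|right].
  by rewrite -e down_gword.
by rewrite -(down_gword (winv w)) gword_winv e winvK.
Qed.

Lemma invariant_string_down (w : word U) : is_string w ->
  ((down_word w).2 <> [::] \/ crease A (down_word w).1) /\
    down_word w = core_inv (down_word w) <-> invariant_string w.
Proof.
move=> sw; have [ww rw _ _] := sw.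
rewrite -down_winv /invariant_string unfolding_word_equiv.
have simple_fixed : w.2 = [::] -> gword w = w <-> crease A (val w.1).1.
  rewrite -gvertex_fixed; case: {sw ww rw} w => v s /= ->.
  by rewrite /gword /=; split=> [[->]|/eqP ->].
split=> [[ns e]|].
  have [e1|e1] := down_eq fgA sw (unfolding_string_winv fgA sw) e; last first.
    by right; rewrite -e1 winvK.
  case: (EM (w.2 = [::])) => [w0|w0].
    left; apply/esym/simple_fixed => //; case: ns => //.
    by rewrite /down_word /cover_word w0.
  by case: (reduced_winv_neq rw w0).
have core0 : (down_word w).2 = [::] -> w.2 = [::].
  by move=> /(congr1 size); rewrite !size_map => /size0nil.
case=> e.
  have w0 : w.2 = [::].
    apply: contrapT => w0; have [] := @deck_neq _ (cover_word w).
      by move/(congr1 size); rewrite size_map => /size0nil.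
    by rewrite -cover_word_gword -e.
  split; first by right; apply/simple_fixed.
  by congr down_word; move: w0; case: (w) => v s /= ->.
split; last by rewrite -(down_gword (winv w)) gword_winv -e.
case: (EM (w.2 = [::])) => [w0|w0]; last by left => /core0.
right; apply/simple_fixed => //; apply: esym; move: e w0.
by case: (w) => v s + /= es; rewrite es.
Qed.

Lemma symmetric_fold_string (w : gstring U) (r : gstring A) :
  string_rel (fold_string w) r -> symmetric_string r <-> invariant_string w.
Proof.
move=> fr; apply: (iff_trans _ (invariant_string_down (stringP w))).
rewrite -core_fold_string -(symmetric_string_core fgA (stringP _)).
by split; apply: symmetric_string_equiv => //; apply: string_rel_sym.
Qed.

(** * Folding bands *)

Lemma band_rel_refl_U (w : gband U) : band_rel w w.
Proof. by apply/(unfolding_band_equiv (bandP w) (bandP w))/ceq_refl. Qed.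

Lemma band_rel_sym_U (w w' : gband U) : band_rel w w' -> band_rel w' w.
Proof.
move/(unfolding_band_equiv (bandP w) (bandP w')) => h.
exact/(unfolding_band_equiv (bandP w') (bandP w))/(ceq_sym coverK).
Qed.

Lemma band_rel_trans_U (u v w : gband U) : band_rel u v -> band_rel v w -> band_rel u w.
Proof.
move=> /(unfolding_band_equiv (bandP u) (bandP v)) uv.
move=> /(unfolding_band_equiv (bandP v) (bandP w)) vw.
exact/(unfolding_band_equiv (bandP u) (bandP w))/(ceq_trans coverK uv).
Qed.

Lemma band_rel_refl (w : gband A) : band_rel w w.
Proof. by apply/(band_equiv_core fgA (bandP w) (bandP w))/ceq_refl. Qed.

Lemma band_rel_sym (w w' : gband A) : band_rel w w' -> band_rel w' w.
Proof.
move/(band_equiv_core fgA (bandP w) (bandP w')) => h.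
exact/(band_equiv_core fgA (bandP w') (bandP w))/(ceq_sym oinvK).
Qed.

Lemma band_rel_trans (u v w : gband A) : band_rel u v -> band_rel v w -> band_rel u w.
Proof.
move=> /(band_equiv_core fgA (bandP u) (bandP v)) uv.
move=> /(band_equiv_core fgA (bandP v) (bandP w)) vw.
exact/(band_equiv_core fgA (bandP u) (bandP w))/(ceq_trans oinvK uv).
Qed.

Lemma gband_cover (w : gband U) : cover_band turning onext (cover_word w).
Proof. by have [] := (unfolding_band_iff fgA w).1 (bandP w). Qed.

Lemma gband_core (r : gband A) : band onext (core (band_word r).2).
Proof. exact: core_band (bandP r). Qed.

Lemma fold_band_ex (w : gband U) : exists r : gband A,
  map fst (cover_word w) = unroll turning (core (band_word r).2).
Proof.
have [s bs es] := band_of_cover (gband_cover w).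
by have [r br cr] := band_of_core fgA bs; exists (GBand br); rewrite es -cr.
Qed.

(** The projection of w determines the core of the folded band; the signs of the
    crease symbols and the starting point at a crease vertex are chosen. *)
Definition fold_band (w : gband U) : gband A := proj1_sig (cid (fold_band_ex w)).

Lemma fold_bandE (w : gband U) :
  map fst (cover_word w) = unroll turning (core (band_word (fold_band w)).2).
Proof. by rewrite /fold_band; case: cid. Qed.

Lemma band_equiv_gword (w w' : gband U) :
  band_equiv (gword w) w' <-> ceq cover_inv (map deck (cover_word w)) (cover_word w').
Proof.
by rewrite (unfolding_band_equiv (bandP (g_band w)) (bandP w')) cover_word_gword.
Qed.

Lemma g_band_compat (w w' : gband U) : band_rel w w' -> band_rel (g_band w) (g_band w').
Proof.
move/(unfolding_band_equiv (bandP w) (bandP w')) => e.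
apply/band_equiv_gword; rewrite /= cover_word_gword.
by case: e => /(cyc_map deck); [left | rewrite -revmap_deck; right].
Qed.

Lemma g_bandK (w : gband U) : band_rel (g_band (g_band w)) w.
Proof.
by apply/band_equiv_gword; rewrite /= cover_word_gword map_deckK; apply: ceq_refl.
Qed.

Lemma fold_band_fiber (w w' : gband U) :
  band_rel (fold_band w) (fold_band w') <-> band_rel w' w \/ band_rel w' (g_band w).
Proof.
have swap (v : gband U) : band_rel w' v <-> band_rel v w'.
  by split; apply: band_rel_sym_U.
rewrite !swap; apply: (iff_trans (band_equiv_core fgA (bandP _) (bandP _))).
apply: (iff_trans (cover_ceq oinvK (@onext_inv K A) (@turning_inv K A)
  (gband_cover w) (gband_cover w') (gband_core _) (gband_core _)
  (fold_bandE w) (fold_bandE w'))).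
by rewrite -(unfolding_band_equiv (bandP w) (bandP w')) -band_equiv_gword.
Qed.

Lemma fold_band_surj (r : gband A) : exists w, band_rel (fold_band w) r.
Proof.
have [w bw cw] := band_of_cover_word fgA (cover_of_band turning false (gband_core r)).
exists (GBand bw); apply/(band_equiv_core fgA (bandP _) (bandP _)); left.
have := fold_bandE (GBand bw); rewrite /= cw fst_lift => /unroll_eq <-.
- exact: cyc_refl.
- by have [] := gband_core r.
by have [] := gband_core (fold_band (GBand bw)).
Qed.

Lemma odd_fold_band (w : gband U) (r : gband A) : band_rel (fold_band w) r ->
  odd (ncrease r) <->
  exists2 u, subword u w & band_equiv w (wcat (gword u) u).
Proof.
move/(band_equiv_core fgA (bandP _) (bandP r)) => fr.
rewrite (ncrease_core fgA (bandP r)).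
rewrite (ceq_parity (@turning_inv K A) (gband_core _) fr).
rewrite (odd_bandP oinvK (@onext_inv K A) (@turning_inv K A) (gband_cover w)
  (gband_core _) (fold_bandE w)).
apply: iff_sym; apply: (halves_iff fgA _ _ _ _ (bandP w)) => [u|u|u|u].
- exact: cover_word_gword.
- exact: gword_word.
- by rewrite size_map.
exact: wcat_gword.
Qed.

Lemma symmetric_fold_band (w : gband U) (r : gband A) : band_rel (fold_band w) r ->
  symmetric_band r <->
  exists2 u, subword u w & band_equiv w (wcat (winv (gword u)) u).
Proof.
move/(band_equiv_core fgA (bandP _) (bandP r)) => fr.
rewrite (symmetric_band_core fgA (bandP r)).
have -> : reversible oinv (core (band_word r).2) <->
          reversible oinv (core (band_word (fold_band w)).2).
  by split; apply: ceq_reversible => //; apply: (ceq_sym oinvK).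
rewrite (reversible_bandP oinvK (@oinv_neq K A) (@onext_inv K A) (@turning_inv K A)
  (@turning_back K A) (gband_cover w) (gband_core _) (fold_bandE w)).
apply: iff_sym.
apply: (halves_iff (h := fun u => winv (gword u))
  (hc := fun c => revmap cover_inv (map deck c)) fgA _ _ _ _ (bandP w)) => [u|u|u|u].
- by rewrite cover_word_winv cover_word_gword.
- by move=> /gword_word; apply: winv_word.
- by rewrite size_rev !size_map.
by move=> ru _; apply: wcat_winv_gword.
Qed.

Lemma invariant_fold_band (w : gband U) (r : gband A) : band_rel (fold_band w) r ->
  invariant_band w <-> odd (ncrease r) \/ symmetric_band r.
Proof.
move/(band_equiv_core fgA (bandP _) (bandP r)) => fr.
rewrite (ncrease_core fgA (bandP r)) (symmetric_band_core fgA (bandP r)).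
rewrite (ceq_parity (@turning_inv K A) (gband_core _) fr).
have -> : reversible oinv (core (band_word r).2) <->
          reversible oinv (core (band_word (fold_band w)).2).
  by split; apply: ceq_reversible => //; apply: (ceq_sym oinvK).
rewrite -(invariant_bandP oinvK (@oinv_neq K A) (@onext_inv K A) (@turning_inv K A)
  (@turning_back K A) (gband_cover w) (gband_core _) (fold_bandE w)).
exact: band_equiv_gword.
Qed.

Lemma symmetric_band_even (r : gband A) : symmetric_band r -> ~~ odd (ncrease r).
Proof.
rewrite (symmetric_band_core fgA (bandP r)) (ncrease_core fgA (bandP r)).
exact: (reversible_even oinvK (@oinv_neq K A) (@onext_inv K A) (@turning_inv K A)
  (@turning_back K A) (gband_core r)).
Qed.

End Folding.

(** * The folding theorem *)

Theorem mainTheorem2 (K : fieldType) (A : triple K) :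
  folded_gentle A -> finite_dimensional A ->
  exists (actS : {action 'Z_2 &-> strings (unfolding A)})
         (actB : {action 'Z_2 &-> bands (unfolding A)}),
  [/\
    (* (a) *)
    (forall w : gstring (unfolding A), exists2 gw : gstring (unfolding A),
       string_word gw = gword w &
       actS (string_class w) Z2gen = string_class gw) /\
    (forall w : gband (unfolding A), exists2 gw : gband (unfolding A),
       band_word gw = gword w &
       actB (band_class w) Z2gen = band_class gw),
    (* (b) *)
    exists2 phi : orbits actS -> strings A, bijective phi &
    exists rho : strings (unfolding A) -> strings A,
    [/\ forall C, rho C = phi (orbit_of actS C),
        surjective_fun rho,
        (* (i) *)
        forall w w' : gstring (unfolding A),
          rho (string_class w) = rho (string_class w') <->
          word_equiv w' w \/ word_equiv w' (gword w) &
        (* (ii) *)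
        forall (w : gstring (unfolding A)) (r : gstring A),
          rho (string_class w) = string_class r ->
          symmetric_string r <-> invariant_string w] &
    (* (c) *)
    exists2 phi : orbits actB -> bands A, bijective phi &
    exists rho : bands (unfolding A) -> bands A,
    [/\ forall C, rho C = phi (orbit_of actB C),
        surjective_fun rho,
        (* (i) *)
        forall w w' : gband (unfolding A),
          rho (band_class w) = rho (band_class w') <->
          band_equiv w' w \/ band_equiv w' (gword w) &
        forall (w : gband (unfolding A)) (r : gband A),
          rho (band_class w) = band_class r ->
          [/\ (* (ii) *)
              [/\ odd (ncrease r) <->
                    exists2 u, subword u w & band_equiv w (wcat (gword u) u),
                  odd (ncrease r) -> ~ symmetric_band r &
                  (exists2 u, subword u w & band_equiv w (wcat (gword u) u)) ->
                    invariant_band w],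
              (* (iii) *)
              ~ symmetric_band r /\ ~~ odd (ncrease r) <->
                ~ invariant_band w &
              (* (iv) *)
              (symmetric_band r <->
                 exists2 u, subword u w &
                   band_equiv w (wcat (winv (gword u)) u)) /\
              ((exists2 u, subword u w &
                   band_equiv w (wcat (winv (gword u)) u)) ->
                 invariant_band w)]]].
Proof.
move=> fgA _.
have [actS [actSE [phiS bijS [rhoS [rhoSE rhoS_surj rhoSf]]]]] :=
  orbit_quotient (@string_rel_refl _ _) (@string_rel_sym _ _) (@string_rel_trans _ _)
    (@string_rel_refl _ _) (@string_rel_sym _ _) (@string_rel_trans _ _)
    (@g_string_compat _ _ fgA) (@g_stringK _ _ fgA)
    (@fold_string_surj _ _ fgA) (@fold_string_fiber _ _ fgA).
have [actB [actBE [phiB bijB [rhoB [rhoBE rhoB_surj rhoBf]]]]] :=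
  orbit_quotient (@band_rel_refl_U _ _) (@band_rel_sym_U _ _) (@band_rel_trans_U _ _)
    (@band_rel_refl _ _ fgA) (@band_rel_sym _ _ fgA) (@band_rel_trans _ _ fgA)
    (@g_band_compat _ _ fgA) (@g_bandK _ _ fgA)
    (@fold_band_surj _ _ fgA) (@fold_band_fiber _ _ fgA).
have classS (r r' : gstring A) : string_class r = string_class r' <-> string_rel r r'.
  by apply: class_of_eq; [apply: string_rel_refl | apply: string_rel_sym |
    apply: string_rel_trans].
have classB (r r' : gband A) : band_class r = band_class r' <-> band_rel r r'.
  by apply: class_of_eq; [apply: band_rel_refl | apply: band_rel_sym |
    apply: band_rel_trans].
exists actS, actB; split.
- split=> w; first by exists (g_string fgA w); last exact: actSE.
  by exists (g_band fgA w); last exact: actBE.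
- exists phiS => //; exists rhoS; split=> // w w'.
    by rewrite !rhoSf; apply: iff_trans (classS _ _) (fold_string_fiber fgA w w').
  by rewrite rhoSf => /classS/symmetric_fold_string.
exists phiB => //; exists rhoB; split=> // w w'.
  by rewrite !rhoBf; apply: iff_trans (classB _ _) (fold_band_fiber fgA w w').
rewrite rhoBf => /classB fr.
have oddE := odd_fold_band fr; have symE := symmetric_fold_band fr.
have invE := invariant_fold_band fr.
split; last by split=> // /symE ?; apply/invE; right.
  split=> //; last by move/oddE => ?; apply/invE; left.
  by move=> odd_r /symmetric_band_even; rewrite odd_r => /(_ fgA).
rewrite invE; split=> [[ns /negP no] [//|//]|no].
by split; [move=> s; apply: no; right | apply/negP => o; apply: no; left].
Qed.
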